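(* Let $\eta > 0$ and let $v \geq 3$ be an integer. Let $\{f_q\}$ be a countable family of functions $f_q : \mathbb{R}^v \to \mathbb{R}$ with the following properties: (a) for each $q$ there exists $r_q < \infty$ such that $f_q \in C^{r_q}([0,\eta]^v)$; (b) for each $q$, some partial derivative of $f_q$ of order $r_q \geq 1$ does not vanish at any point of $[0,\eta]^v$. Then there exists a set $E \subseteq [0,\eta]$ of Hausdorff dimension at least $\frac{1}{v-1}$ and Minkowski dimension $1$ such that $f_q(x_1, \ldots, x_v) \neq 0$ for every $v$-tuple of distinct points $x_1, \ldots, x_v \in E$ and every function $f_q$ of the family.
   Context: Each $r_q$ is a positive integer (which may depend on $q$). A partial derivative of order $r$ means $\partial^{\beta_1+\cdots+\beta_v} / \partial x_1^{\beta_1}\cdots \partial x_v^{\beta_v}$ with nonnegative integers $\beta_i$ and $\beta_1 + \cdots + \beta_v = r$. ''Distinct points'' means pairwise distinct. *)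

(* Defs.v *)
From HB Require Import structures.
From mathcomp Require Import all_boot all_order all_algebra.
From mathcomp Require Import all_classical all_reals all_analysis.
Import numFieldNormedType.Exports.

Set Implicit Arguments.
Unset Strict Implicit.
Unset Printing Implicit Defensive.

Import Order.TTheory GRing.Theory Num.Theory.

Local Open Scope classical_set_scope.
Local Open Scope ring_scope.

Definition cube (R : realType) (v : nat) (eta : R) : set 'rV[R]_v :=
  [set x | forall i, 0 <= x ord0 i <= eta].

Definition diff_quotient (R : realType) (v : nat) (i : 'I_v)
    (g : 'rV[R]_v -> R) (x : 'rV[R]_v) (h : R) : R :=
  h^-1 * (g (x + h *: delta_mx ord0 i) - g x).

(* The increments h that are allowed keep x + h e_i inside K, so that the
   partial derivatives on a face of the closed cube are one-sided. *)
Definition increments (R : realType) (v : nat) (K : set 'rV[R]_v) (i : 'I_v)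
    (x : 'rV[R]_v) : set_system R :=
  within [set h : R | K (x + h *: delta_mx ord0 i)] (0^').

Definition has_partial (R : realType) (v : nat) (K : set 'rV[R]_v) (i : 'I_v)
    (g : 'rV[R]_v -> R) (x : 'rV[R]_v) : Prop :=
  cvg (diff_quotient i g x @ increments K i x).

(* Meaningful only where [has_partial] holds: [lim] is total. *)
Definition partial (R : realType) (v : nat) (K : set 'rV[R]_v) (i : 'I_v)
    (g : 'rV[R]_v -> R) (x : 'rV[R]_v) : R :=
  lim (diff_quotient i g x @ increments K i x).

Fixpoint is_Cn (R : realType) (v : nat) (K : set 'rV[R]_v) (r : nat)
    (g : 'rV[R]_v -> R) : Prop :=
  {within K, continuous g} /\
  if r is r'.+1 then
    forall i : 'I_v,
      (forall x, K x -> has_partial K i g x) /\ is_Cn K r' (partial K i g)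
  else True.

(* [multi_partial K b g] is d^(b_1 + ... + b_v) g / d x_1^b_1 ... d x_v^b_v. *)
Definition multi_partial (R : realType) (v : nat) (K : set 'rV[R]_v)
    (b : 'I_v -> nat) (g : 'rV[R]_v -> R) : 'rV[R]_v -> R :=
  foldr (fun i => iter (b i) (partial K i)) g (enum 'I_v).

Local Open Scope ereal_scope.

Definition diam (R : realType) (U : set R) : \bar R :=
  ereal_sup [set `|x - y|%:E | x in U & y in U].

(* The empty set has weight 0 for every s, also for s = 0. *)
Definition diam_pow (R : realType) (s : R) (U : set R) : \bar R :=
  if U == set0 then 0 else poweR (diam U) s.

Definition hausdorff_premeasure (R : realType) (s d : R) (A : set R) : \bar R :=
  ereal_inf [set \sum_(0 <= k <oo) diam_pow s (U k) | U in
    [set U : nat -> set R |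
      A `<=` \bigcup_k U k /\ forall k, diam (U k) <= d%:E]].

Definition hausdorff_measure (R : realType) (s : R) (A : set R) : \bar R :=
  ereal_sup [set hausdorff_premeasure s d A | d in [set d : R | (0 < d)%R]].

Definition hausdorff_dim (R : realType) (A : set R) : \bar R :=
  ereal_inf [set s%:E | s in
    [set s : R | (0 <= s)%R /\ hausdorff_measure s A = 0]].

(* Least number of closed intervals of length d covering A, +oo if there is
   no finite cover. *)
Definition covering_number (R : realType) (A : set R) (d : R) : \bar R :=
  ereal_inf [set n%:R%:E | n in
    [set n : nat | exists c : 'I_n -> R,
      A `<=` [set x | exists i, (c i <= x <= c i + d)%R]]].

(* The lower and upper Minkowski (box-counting) dimensions of A are both D. *)
Definition has_minkowski_dim (R : realType) (A : set R) (D : R) : Prop :=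
  lne (covering_number A d) * ((- ln d)^-1)%:E @[d --> 0^'+] --> D%:E.

(* Main.v *)
(* Cover [0, 1/M_0[ by nested grids: each cell of generation [n] has [N] blocks
   of [L] children, at most one child per block is selected, and [E] consists of
   the points whose cells are selected from some generation on.  Selection may
   start in an arbitrary cell of an arbitrary generation, so [E] is dense in
   [0, 1/M_0[, hence has Minkowski dimension 1.

   To make a C^1 function [g] with [|d_i g| >= c] on a product of cells
   nonzero, select the first child of every block in the cells of the
   coordinates other than [i].  With [p = v - 1] these children give at most
   (B N)^p positions, where [B] is the number of cells, and each of them spoils
   a bounded number of children in the cells of the coordinate [i].  So if [L]
   is a large multiple of [N^(p-1)] almost all blocks keep an unspoiled child.
   Descending one derivative at a time this leads from the nonvanishing partial
   derivative to [f_q] itself; all the tasks are performed in turn, each one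
   infinitely often.

   As N L is a multiple kappa N^p, with kappa fixed before N, the mass 1/N of a
   child is about its size to the power 1/p.  So the distribution function [F]
   of the natural mass on [E] is Holder continuous of every exponent s < 1/p,
   and it maps [E] onto an interval; a cover of [E] by sets [U_k] is mapped to a
   cover of that interval by sets of length at most C diam(U_k)^s. *)

Require Import Defs.
From HB Require Import structures.
From mathcomp Require Import all_boot all_order all_algebra.
From mathcomp Require Import all_classical all_reals all_analysis.
From mathcomp Require Import zify ring lra.
Import numFieldNormedType.Exports.
Import Order.TTheory GRing.Theory Num.Theory.

Set Implicit Arguments.
Unset Strict Implicit.
Unset Printing Implicit Defensive.

Local Open Scope classical_set_scope.
Local Open Scope ring_scope.

(** * Grid cells and counting *)

Section Blocks.
Local Open Scope nat_scope.

Lemma sum_blocks (a b m : nat) (F : nat -> nat) :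
  \sum_(a * m <= j < b * m) F j = \sum_(a <= k < b) \sum_(0 <= i < m) F (k * m + i).
Proof.
case: (leqP a b) => [ab|ba]; last by rewrite !big_geq ?leq_mul2r ?(ltnW ba) ?orbT.
rewrite -(subnKC ab); elim: (b - a) => [|d IH]; first by rewrite addn0 !big_geq.
rewrite addnS big_nat_recr ?leq_addr //= -IH mulSn addnC.
rewrite (@big_cat_nat _ _ _ ((a + d) * m)) ?leq_addr ?leq_mul2r ?leq_addr ?orbT //=.
congr (_ + _); rewrite -{1}(add0n ((a + d) * m)) big_addn addKn.
by apply: eq_bigr => i _; rewrite addnC.
Qed.

Lemma sum_blocks0 (b m : nat) (F : nat -> nat) :
  \sum_(0 <= j < b * m) F j = \sum_(0 <= k < b) \sum_(0 <= i < m) F (k * m + i).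
Proof. by rewrite -sum_blocks mul0n. Qed.

Definition one_per_block (L : nat) (S : pred nat) :=
  forall u b b', b < L -> b' < L -> S (u * L + b) -> S (u * L + b') -> b = b'.

Lemma one_per_block_sum (L u : nat) (S : pred nat) : one_per_block L S ->
  \sum_(0 <= b < L) S (u * L + b) <= 1.
Proof.
move=> blk.
have [/existsP[b0 Sb0]|/existsPn noS] :=
  boolP [exists b : 'I_L, S (u * L + b)]; last first.
  by rewrite big_mkord big1 // => b _; rewrite (negbTE (noS b)).
rewrite big_mkord (bigD1 b0) //= big1 ?addn0 ?leq_b1 // => b bb0.
case Sb: (S _) => //.
by rewrite -(inj_eq val_inj) /= (blk _ _ _ _ _ Sb Sb0) ?eqxx in bb0.
Qed.

Lemma one_per_block_child (N L k : nat) (S : pred nat) : one_per_block L S ->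
  \sum_(0 <= i < N * L) S (k * (N * L) + i) <= N.
Proof.
move=> blk.
rewrite sum_blocks0.
apply: (@leq_trans (\sum_(0 <= a < N) 1)); last by rewrite sum_nat_const_nat subn0 muln1.
apply: leq_sum => a _.
under eq_bigr do rewrite mulnA addnA -mulnDl.
exact: one_per_block_sum.
Qed.

Lemma sum_widen_blocks (lo hi m : nat) (F : nat -> nat) : 0 < m ->
  \sum_(lo <= j < hi.+1) F j <=
  \sum_(lo %/ m <= k < (hi %/ m).+1) \sum_(0 <= i < m) F (k * m + i).
Proof.
move=> m0; rewrite -sum_blocks.
have lo1 : lo %/ m * m <= lo by rewrite leq_divM.
have hi1 : hi.+1 <= (hi %/ m).+1 * m by rewrite ltn_ceil.
case: (leqP lo hi.+1) => [lohi|hilo]; last by rewrite big_geq // ltnW.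
rewrite [leqRHS](big_cat_nat lo1) ?(leq_trans lohi) //=.
rewrite [X in _ <= _ + X](big_cat_nat lohi) //=.
by rewrite addnCA leq_addr.
Qed.

Lemma one_per_block_window (L lo hi : nat) (S : pred nat) : 0 < L ->
  one_per_block L S -> lo <= hi ->
  \sum_(lo <= j < hi.+1) S j <= (hi %/ L - lo %/ L).+1.
Proof.
move=> L0 blk lohi; apply: leq_trans (sum_widen_blocks _ _ _ L0) _.
apply: (@leq_trans (\sum_(lo %/ L <= k < (hi %/ L).+1) 1)).
  by apply: leq_sum => k _; exact: one_per_block_sum.
by rewrite sum_nat_const_nat muln1 subSn // leq_div2r.
Qed.

End Blocks.

Section Cells.
Variable R : realType.

(** For [x >= 0], the index [k] of the half-open cell [[k/M, (k+1)/M[] containing [x]; negative [x]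
    are sent to 0. *)
Definition cell (M : nat) (x : R) : nat := Num.truncn (x * M%:R).

Lemma cell_itv (M : nat) (x : R) : (0 < M)%N -> 0 <= x ->
  (cell M x)%:R / M%:R <= x < (cell M x).+1%:R / M%:R.
Proof.
move=> M0 x0; rewrite ler_pdivrMr ?ltr0n // ltr_pdivlMr ?ltr0n //.
by apply: truncn_itv; rewrite mulr_ge0.
Qed.

Lemma cellP (M k : nat) (x : R) : (0 < M)%N ->
  k%:R / M%:R <= x < k.+1%:R / M%:R -> cell M x = k.
Proof.
move=> M0; rewrite ler_pdivrMr ?ltr0n // ltr_pdivlMr ?ltr0n //.
exact: truncn_def.
Qed.

Lemma cell_divn (M m : nat) (x : R) : (0 < M)%N -> (0 < m)%N -> 0 <= x ->
  (cell (M * m) x %/ m)%N = cell M x.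
Proof.
move=> M0 m0 x0; apply/esym/cellP => //.
have Mm0 : (0 < M * m)%N by rewrite muln_gt0 M0.
have /andP[le1 lt1] := cell_itv Mm0 x0.
set q := cell _ _ in le1 lt1 *.
have m0' : (0 : R) < m%:R by rewrite ltr0n.
have M0' : (0 : R) < M%:R by rewrite ltr0n.
have e (k : nat) : k%:R / M%:R = (k * m)%:R / (M * m)%:R :> R.
  by rewrite !natrM; field; rewrite !gt_eqF.
rewrite !e; apply/andP; split.
  by apply: le_trans le1; rewrite ler_pM2r ?invr_gt0 ?ltr0n // ler_nat leq_divM.
by apply: lt_le_trans lt1 _; rewrite ler_pM2r ?invr_gt0 ?ltr0n // ler_nat ltn_ceil.
Qed.

Lemma le_cell (M : nat) : {homo cell M : x y / x <= y >-> (x <= y)%N}.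
Proof. by move=> x y xy; apply: le_truncn; rewrite ler_wpM2r. Qed.

Lemma cell_lt (M k : nat) (x : R) : (0 < M)%N -> 0 <= x ->
  (cell M x < k)%N = (x < k%:R / M%:R).
Proof.
move=> M0 x0; rewrite ltr_pdivlMr ?ltr0n //.
by rewrite truncn_lt_nat // mulr_ge0.
Qed.

Lemma cell_ge (M k : nat) (x : R) : (0 < M)%N -> 0 <= x ->
  (k <= cell M x)%N = (k%:R / M%:R <= x).
Proof. by move=> M0 x0; rewrite leqNgt cell_lt // -leNgt. Qed.

End Cells.

(** * The distribution function of a Cantor set *)

Section Staircase.
Variables (R : realType) (M N L : nat -> nat) (S : nat -> pred nat) (k0 : nat).
Hypothesis M0_gt0 : (0 < M 0)%N.
Hypothesis M_rec : forall n, M n.+1 = (M n * (N n * L n))%N.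
Hypothesis N_gt1 : forall n, (1 < N n)%N.
Hypothesis L_gt0 : forall n, (0 < L n)%N.
Hypothesis S_block : forall n, one_per_block (L n) (S n).
(* A proportion at most [2 ^- n.+2] of the blocks is lost in generation [n], so
   that at least half of the mass survives. *)
Hypothesis S_many : forall n k,
  (2 ^ n.+2 * N n <=
   2 ^ n.+2 * (\sum_(0 <= i < N n * L n) S n (k * (N n * L n) + i)) + N n)%N.

(** These are the descendants of the initial cell [k0] that are selected along with all their
    ancestors after generation 0; the quotient of [j] is its parent. *)
Fixpoint alive (n : nat) : pred nat :=
  if n is n'.+1 then fun j => alive n' (j %/ (N n' * L n'))%N && S n' j
  else pred1 k0.

(** The number of alive cells if no block were lost, hence an upper bound. Each alive cell of
    generation [n] gets the mass [1 / nb_cells n]. *)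
Definition nb_cells (n : nat) : nat := (\prod_(i < n) N i)%N.

Definition window (n : nat) (x y : R) : nat :=
  (\sum_(cell (M n) x <= j < (cell (M n) y).+1) alive n j)%N.

Let NL_gt0 n : (0 < N n * L n)%N.
Proof. by rewrite muln_gt0 L_gt0 andbT ltnW. Qed.

Let M_gt0 n : (0 < M n)%N.
Proof. by elim: n => // n IH; rewrite M_rec muln_gt0 IH NL_gt0. Qed.

Let nb_cellsS n : nb_cells n.+1 = (N n * nb_cells n)%N.
Proof. by rewrite /nb_cells big_ord_recr mulnC. Qed.

Let nb_cells_gt0 n : (0 < nb_cells n)%N.
Proof.
elim: n => [|n IH]; first by rewrite /nb_cells big_ord0.
by rewrite nb_cellsS muln_gt0 IH (ltnW (N_gt1 n)).
Qed.

Let nb_cells_ge n : (2 ^ n <= nb_cells n)%N.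
Proof.
elim: n => [|n IH]; first by rewrite /nb_cells big_ord0.
by rewrite nb_cellsS expnS leq_mul.
Qed.

Let alive_child n k i : (i < N n * L n)%N ->
  alive n.+1 (k * (N n * L n) + i)%N = alive n k && S n (k * (N n * L n) + i)%N.
Proof. by move=> iNL /=; rewrite divnMDl // divn_small // addn0. Qed.

Let child_sum_le n k :
  (\sum_(0 <= i < N n * L n) alive n.+1 (k * (N n * L n) + i) <= N n * alive n k)%N.
Proof.
case ak: (alive n k); last first.
  rewrite big_nat_cond big1 // => i /andP[/andP[_ iNL] _].
  by rewrite alive_child // ak.
rewrite muln1; apply: leq_trans (one_per_block_child (N n) k (@S_block n)).
rewrite big_nat_cond [leqRHS]big_nat_cond.
apply: leq_sum => i /andP[/andP[_ iNL] _].
by rewrite alive_child // ak.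
Qed.

Let window_step n x y : 0 <= x -> 0 <= y ->
  (window n.+1 x y <= N n * window n x y)%N.
Proof.
move=> x0 y0; rewrite /window.
apply: leq_trans (sum_widen_blocks _ _ _ (NL_gt0 n)) _.
rewrite M_rec !cell_divn // big_distrr /=.
by apply: leq_sum => k _; exact: child_sum_le.
Qed.

(** An alive cell has at most [N n] alive children, so the normalised counts do not increase with
    the generation. *)
Let window_le p n x y : 0 <= x -> 0 <= y -> (p <= n)%N ->
  (window n x y)%:R / (nb_cells n)%:R <= (window p x y)%:R / (nb_cells p)%:R :> R.
Proof.
move=> x0 y0; elim: n => [|n IH]; first by rewrite leqn0 => /eqP ->.
rewrite leq_eqVlt => /predU1P[-> //|]; rewrite ltnS => /IH; apply: le_trans.
rewrite nb_cellsS ler_pdivrMr ?ltr0n ?muln_gt0 ?nb_cells_gt0 ?(ltnW (N_gt1 _)) //.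
rewrite natrM mulrCA divfK ?pnatr_eq0 ?gtn_eqF //.
by rewrite -natrM ler_nat window_step.
Qed.

Let window_cat n x y : 0 <= x -> x <= y -> (window n 0 y <= window n 0 x + window n x y)%N.
Proof.
move=> x0 xy; rewrite /window.
have h1 : (cell (M n) (0 : R) <= (cell (M n) x).+1)%N by apply: leqW; exact: le_cell.
have h2 : ((cell (M n) x).+1 <= (cell (M n) y).+1)%N by rewrite ltnS; exact: le_cell.
rewrite (big_cat_nat h1 h2) /= leq_add2l.
by rewrite [leqRHS]big_ltn ?leq_addl // ltnS le_cell.
Qed.

(** The distribution function of the limiting mass: for [x >= 0] the normalised counts are
    nonincreasing in [n], so their infimum is their limit. *)
Definition staircase (x : R) : R :=
  inf [set (window n 0 x)%:R / (nb_cells n)%:R | n in [set: nat]].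

Let stair_has_inf x :
  has_inf [set ((window n 0 x)%:R / (nb_cells n)%:R : R) | n in [set: nat]].
Proof.
split; first by exists ((window 0 0 x)%:R / (nb_cells 0)%:R); exists 0%N.
by exists 0 => _ [n _ <-]; rewrite divr_ge0.
Qed.

Let staircase_le n x : staircase x <= (window n 0 x)%:R / (nb_cells n)%:R.
Proof. by apply: ge_inf; [exact: (stair_has_inf x).2 | exists n]. Qed.

Lemma staircase_window p x y : 0 <= x -> x <= y ->
  staircase y <= staircase x + (window p x y)%:R / (nb_cells p)%:R.
Proof.
move=> x0 xy; apply/ler_addgt0Pr => e e0.
have [_ [n0 _ <-] ltn0] := inf_adherent e0 (stair_has_inf x).
rewrite -/(staircase x) in ltn0.
pose n := maxn p n0.
apply: le_trans (staircase_le n y) _.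
have := window_cat n x0 xy; rewrite -(ler_nat R) natrD => h.
apply: (@le_trans _ _ ((window n 0 x)%:R / (nb_cells n)%:R +
    (window n x y)%:R / (nb_cells n)%:R)).
  by rewrite -mulrDl ler_pM2r ?invr_gt0 ?ltr0n.
rewrite addrAC lerD //.
  by apply: le_trans (ltW ltn0); apply: window_le => //; exact: leq_maxr.
by apply: window_le => //; [exact: le_trans xy | exact: leq_maxl].
Qed.

Lemma staircase_homo : {homo staircase : x y / x <= y}.
Proof.
move=> x y xy; apply: lb_le_inf; first exact: (stair_has_inf y).1.
move=> _ [n _ <-]; apply: le_trans (staircase_le n x) _.
rewrite ler_pM2r ?invr_gt0 ?ltr0n // ler_nat /window.
rewrite [leqRHS](@big_cat_nat _ _ _ (cell (M n) x).+1) ?leq_addr //=.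
  by rewrite /cell mul0r truncn0.
by rewrite ltnS le_cell.
Qed.

Lemma staircase0 : staircase 0 <= 0.
Proof.
apply/ler_addgt0Pr => e e0; rewrite add0r.
have [n ne] : exists n, e^-1 < n%:R.
  by exists (Num.truncn e^-1).+1; exact: truncnS_gt.
apply: le_trans (staircase_le n 0) _.
rewrite ler_pdivrMr ?ltr0n // /window big_nat1.
apply: (@le_trans _ _ 1); first by rewrite lern1 leq_b1.
rewrite -[leLHS](mulfV (lt0r_neq0 e0)) ler_pM2l //.
apply: ltW; apply: (lt_trans ne); rewrite ltr_nat.
exact: leq_trans (ltn_expl n (ltnSn 1)) (nb_cells_ge n).
Qed.

Let scale (n : nat) : nat := (\prod_(i < n) (N i * L i))%N.

Let scaleS n : scale n.+1 = (scale n * (N n * L n))%N.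
Proof. by rewrite /scale big_ord_recr. Qed.

Let M_scale n : M n = (M 0 * scale n)%N.
Proof.
elim: n => [|n IH]; first by rewrite /scale big_ord0 muln1.
by rewrite M_rec IH scaleS -mulnA.
Qed.

Let total (n : nat) := (\sum_(0 <= j < k0.+1 * scale n) alive n j)%N.

Let totalS n :
  total n.+1 = (\sum_(0 <= k < k0.+1 * scale n)
     \sum_(0 <= i < N n * L n) alive n.+1 (k * (N n * L n) + i))%N.
Proof.
by rewrite /total scaleS mulnA sum_blocks0.
Qed.

(** In proportions, at least [1/2 + 2 ^- n.+1] of the mass survives at generation [n]. The
    proportion lost next, at most [2 ^- n.+2], is exactly the drop of this bound. *)
Let total_ge n : ((2 ^ n + 1) * nb_cells n <= 2 ^ n.+1 * total n)%N.
Proof.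
elim: n => [|n IH].
  rewrite /total /nb_cells /scale !big_ord0 !muln1.
  by rewrite (bigD1_seq k0) ?mem_index_iota ?iota_uniq //= eqxx mulnDr; exact: leq_addr.
have step : (2 ^ n.+2 * N n * total n <= 2 ^ n.+2 * total n.+1 + N n * total n)%N.
  rewrite totalS /total !big_distrr -big_split /=.
  apply: leq_sum => k _.
  case ak: (alive n k); last by rewrite !muln0.
  rewrite !muln1; apply: leq_trans (S_many n k) _.
  rewrite leq_add2r leq_mul2l; apply/orP; right.
  rewrite big_nat_cond [leqRHS]big_nat_cond.
  apply: leq_sum => i /andP[/andP[_ iNL] _].
  by rewrite divnMDl // divn_small // addn0 ak.
rewrite nb_cellsS.
have le_t : (total n <= nb_cells n)%N.
  move=> {IH step}; elim: n => [|n IH].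
    rewrite /total /nb_cells /scale !big_ord0 !muln1.
    rewrite (bigD1_seq k0) ?mem_index_iota ?iota_uniq //= eqxx.
    by rewrite big1 // => i /negbTE ->.
  rewrite totalS nb_cellsS.
  apply: (@leq_trans (N n * total n)); last by rewrite leq_mul2l IH orbT.
  by rewrite /total big_distrr /=; apply: leq_sum => k _; exact: child_sum_le.
have le_Nt : (N n * total n <= N n * nb_cells n)%N by rewrite leq_mul2l le_t orbT.
have IH' : (2 * N n * ((2 ^ n + 1) * nb_cells n) <= 2 * N n * (2 ^ n.+1 * total n))%N.
  by rewrite leq_mul2l IH orbT.
move: step IH' le_Nt; rewrite !expnS; set e := (2 ^ n)%N.
move: (total n) (total n.+1) (nb_cells n) (N n) => t t' a b.
nia.
Qed.

Lemma staircase_right x : k0.+1%:R / (M 0)%:R <= x -> 2^-1 <= staircase x.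
Proof.
move=> xk; apply: lb_le_inf; first exact: (stair_has_inf x).1.
move=> _ [n _ <-].
have x0 : 0 <= x by apply: le_trans xk; rewrite divr_ge0.
have tw : (total n <= window n 0 x)%N.
  rewrite /window /cell mul0r truncn0 -/(cell _ _).
  have h : (k0.+1 * scale n <= (cell (M n) x).+1)%N.
    apply: leqW; rewrite cell_ge // M_scale; apply: le_trans xk.
    rewrite !natrM invfM mulrACA divff ?mulr1 //.
    rewrite pnatr_eq0 gtn_eqF // /scale prodn_gt0 //.
  by rewrite [leqRHS](big_cat_nat _ h) //= leq_addr.
rewrite ler_pdivlMr ?ltr0n // mulrC ler_pdivrMr // -natrM ler_nat.
have := total_ge n; rewrite expnS; have : (0 < 2 ^ n)%N by rewrite expn_gt0.
move: tw; set e := (2 ^ n)%N.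
move: (total n) (window n 0 x) (nb_cells n) => t w a.
nia.
Qed.


Let nb_cells_geN n : (N n <= nb_cells n.+1)%N.
Proof. by rewrite nb_cellsS leq_pmulr. Qed.

(** Each block, of length [1 / (M n * N n)], holds at most one alive cell, and an interval of length
    [y - x] meets at most [(y - x) * M n * N n + 2] blocks. *)
Lemma window_bound n x y : 0 <= x -> x <= y ->
  (window n.+1 x y)%:R / (nb_cells n.+1)%:R <=
  (y - x) * (M n)%:R / (nb_cells n)%:R + 2 / (nb_cells n.+1)%:R.
Proof.
move=> x0 xy; have y0 := le_trans x0 xy.
have MN0 : (0 < M n * N n)%N by rewrite muln_gt0 M_gt0 ltnW.
have : (window n.+1 x y <= (cell (M n * N n) y - cell (M n * N n) x).+1)%N.
  rewrite -!(@cell_divn _ (M n * N n) (L n)) // -mulnA -M_rec.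
  apply: leq_trans (one_per_block_window (L_gt0 n) (@S_block n) (le_cell _ xy)).
  by apply: leq_sum => j _ /=; case: (alive n _).
rewrite -(ler_nat R) -natr1 natrB; last exact: le_cell.
have /andP[+ _] := cell_itv MN0 y0; have /andP[_ +] := cell_itv MN0 x0.
rewrite ler_pdivrMr ?ltr_pdivlMr ?ltr0n // -natr1.
move: (cell _ x)%:R (cell _ y)%:R (window _ _ _)%:R => cx cy w h1 h2 h3.
have a0 : 0 < (nb_cells n)%:R :> R by rewrite ltr0n.
have N0 : 0 < (N n)%:R :> R by rewrite ltr0n ltnW.
rewrite nb_cellsS natrM.
have -> : (y - x) * (M n)%:R / (nb_cells n)%:R + 2 / ((N n)%:R * (nb_cells n)%:R) =
   ((y - x) * (M n * N n)%:R + 2) / ((N n)%:R * (nb_cells n)%:R) :> R.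
  by rewrite natrM; field; rewrite !gt_eqF.
rewrite ler_pM2r ?invr_gt0 ?mulr_gt0 //.
by lra.
Qed.

Lemma staircase_le1 x : staircase x <= 1.
Proof.
apply: le_trans (staircase_le 0 x) _.
rewrite /nb_cells big_ord0 divr1 -[leRHS]/(1%:R) ler_nat /window.
have -> : cell (M 0) (0 : R) = 0%N by rewrite /cell mul0r truncn0.
rewrite big_mkord.
have [h|h] := ltnP k0 (cell (M 0) x).+1; last first.
  rewrite big1 // => i _ /=; case: eqP => // ik.
  by have := leq_trans (ltn_ord i) h; rewrite ik ltnn.
rewrite (bigD1 (Ordinal h)) //= eqxx big1 // => i.
by rewrite -(inj_eq val_inj) /= => /negbTE ->.
Qed.

Lemma staircase_ge0 x : 0 <= staircase x.
Proof.
apply: lb_le_inf; first exact: (stair_has_inf x).1.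
by move=> _ [n _ <-]; rewrite divr_ge0.
Qed.

(** * Holder continuity and range of the staircase *)

Variables (s : R) (n0 : nat).
Hypothesis s_gt0 : 0 < s.
Hypothesis s_lt1 : s < 1.
(** The share [1 / N n] of a child in the mass of its parent is at most its length [1 / M n.+1] to
    the power [s]. *)
Hypothesis M_pow : forall n, (n0 <= n)%N -> (M n.+1)%:R `^ s <= (N n)%:R :> R.

Let M_ge n : (2 ^ n <= M n)%N.
Proof.
elim: n => [|n IH]; first exact: M_gt0.
by rewrite M_rec expnSr leq_mul // -[leqLHS]muln1 leq_mul.
Qed.

(** For [l = y - x], take the generation with [1 / M n.+1 <= l < 1 / M n]: the two terms of
    [window_bound] are at most the power [s] of [l] and twice that power, whence the constant 3.
    Long intervals use [staircase <= 1]. *)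
Lemma staircase_holder : exists2 C : R, 0 < C &
  forall x y, 0 <= x -> x <= y -> staircase y <= staircase x + C * (y - x) `^ s.
Proof.
pose D : R := (M n0.+1)%:R.
have D0 : 0 < D by rewrite ltr0n.
exists (3 + D `^ s); first by rewrite addr_gt0 ?powR_gt0.
move=> x y x0 xy.
have [->|xy'] := eqVneq x y; first by rewrite lerDl mulr_ge0 ?addr_ge0 ?powR_ge0.
have l0 : 0 < y - x by rewrite subr_gt0 lt_neqAle xy' xy.
set l := y - x in l0 *.
have ls0 : 0 < l `^ s by rewrite powR_gt0.
have [Dl|lD] := leP 1 (l * D).
  apply: le_trans (staircase_le1 y) _; rewrite -[leLHS]add0r lerD ?staircase_ge0 //.
  rewrite mulrDl -[leLHS]add0r lerD ?mulr_ge0 // ?(ltW ls0) //.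
  rewrite mulrC -powRM ?(ltW l0) ?(ltW D0) //.
  rewrite -[leLHS](powRr0 (l * D)).
  by apply: ler_powR => //; exact: ltW.
pose P j := 1 <= l * (M (n0.+1 + j)%N)%:R.
have exP : exists j, P j.
  exists (Num.truncn l^-1).+1; rewrite /P mulrC -ler_pdivrMr // div1r.
  apply/ltW/(lt_le_trans (truncnS_gt _)); rewrite ler_nat.
  apply: leq_trans (M_ge _).
  apply: leq_trans (ltnW (ltn_expl _ (ltnSn 1))) _.
  by rewrite leq_exp2l // leq_addl.
case: (ex_minnP exP) => -[|j] Pj minj.
  by move: Pj; rewrite /P addn0 leNgt lD.
have nPj : l * (M (n0.+1 + j)%N)%:R < 1.
  by rewrite ltNge; apply/negP => /minj; rewrite ltnn.
move: Pj; rewrite /P addnS; move: nPj; set n := (n0.+1 + j)%N => nPj Pj.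
apply: le_trans (staircase_window n.+1 x0 xy) _; rewrite lerD2l.
apply: le_trans (window_bound n x0 xy) _.
apply: (@le_trans _ _ (3 * l `^ s)); last first.
  by rewrite ler_pM2r // lerDl powR_ge0.
have Ma0 k : 0 < (M k)%:R :> R by rewrite ltr0n.
have nb_pow k : (n0 <= k)%N -> (M k.+1)%:R `^ s <= (nb_cells k.+1)%:R :> R.
  by move=> /M_pow/le_trans; apply; rewrite ler_nat; exact: nb_cells_geN.
have h1 : l * (M n)%:R / (nb_cells n)%:R <= l `^ s.
  rewrite ler_pdivrMr ?ltr0n //.
  apply: (@le_trans _ _ (l `^ s * (M n)%:R `^ s)).
    rewrite -powRM ?(ltW l0) ?(ltW (Ma0 _)) //.
    by apply: ger1_powR; rewrite ?(ltW s_lt1) // mulr_gt0 //= ltW.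
  rewrite ler_pM2l //; exact: nb_pow (leq_addr _ _).
have h2 : 2 / (nb_cells n.+1)%:R <= 2 * l `^ s.
  rewrite ler_pM2l // -[leLHS]div1r ler_pdivrMr ?ltr0n //.
  apply: (@le_trans _ _ (l `^ s * (M n.+1)%:R `^ s)).
    rewrite -powRM ?(ltW l0) ?(ltW (Ma0 _)) //.
    rewrite -[leLHS](powRr0 (l * (M n.+1)%:R)).
    by apply: ler_powR => //; exact: ltW.
  rewrite ler_pM2l //; apply: nb_pow.
  by rewrite /n addSn leqW // leq_addr.
by rewrite -/l; lra.
Qed.

(** The supremum [z] of the points with value at most [y] works: the value there is [y] by
    continuity, and if some cell of [z] were dead the value would stay [y] a little to the right of
    [z]. *)
Lemma staircase_onto y : 0 < y < 2^-1 ->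
  exists x, [/\ 0 <= x, cell (M 0) x = k0, forall n, S n (cell (M n.+1) x) &
                staircase x = y].
Proof.
move=> /andP[y0 y1]; have [C C0 holder] := staircase_holder.
pose X : set R := [set x | 0 <= x /\ staircase x <= y].
have X0 : X 0 by split=> //; exact: le_trans staircase0 (ltW y0).
have supX : has_sup X.
  split; first by exists 0.
  exists (k0.+1%:R / (M 0)%:R) => x [x0 xy]; rewrite leNgt; apply/negP => /ltW.
  by move/staircase_right/le_trans => /(_ _ xy); rewrite leNgt y1.
pose z := sup X.
have z0 : 0 <= z by exact: ub_le_sup (supX.2) _ X0.
have gap e : 0 < e -> 0 < (e / C) `^ s^-1 /\
    forall t, 0 <= t -> t < (e / C) `^ s^-1 -> C * t `^ s <= e.
  move=> e0; have eC : 0 < e / C by rewrite divr_gt0.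
  split; first exact: powR_gt0.
  move=> t t0 te; rewrite mulrC -ler_pdivlMr //.
  rewrite -[leRHS]powRr1 ?(ltW eC) // -(mulVf (lt0r_neq0 s_gt0)) powRrM.
  by apply: ge0_ler_powR; rewrite ?nnegrE ?powR_ge0 // ltW.
have zy : staircase z = y.
  apply/eqP; rewrite eq_le; apply/andP; split.
    apply/ler_addgt0Pr => e e0; have [d0 gape] := gap e e0.
    have [t [t0 ty] zt] := sup_adherent d0 supX.
    have tz : t <= z by exact: ub_le_sup (supX.2) _ (conj t0 ty).
    apply: le_trans (holder _ _ t0 tz) _; apply: lerD => //.
    by apply: gape; rewrite ?subr_ge0 // ltrBlDr addrC -ltrBlDr.
  apply/ler_addgt0Pr => e e0; have [d0 gape] := gap e e0.
  set d := _ `^ _ in d0 gape.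
  have zd : z < z + d / 2 by rewrite ltrDl divr_gt0.
  apply: (@le_trans _ _ (staircase (z + d / 2))).
    rewrite leNgt; apply/negP => /ltW h.
    have : z + d / 2 <= z.
      by apply: (ub_le_sup supX.2); split=> //; exact: le_trans (ltW zd).
    by rewrite leNgt zd.
  apply: le_trans (holder _ _ z0 (ltW zd)) _; rewrite lerD2l.
  by apply: gape; lra.
have zalive n : alive n (cell (M n) z).
  apply/negPn/negP => dead.
  have /andP[_ zr] := cell_itv (M_gt0 n) z0.
  set r := _ / _ in zr.
  pose t := (z + r) / 2.
  have zt : z < t by rewrite /t; lra.
  have tr : t < r by rewrite /t; lra.
  have ct : cell (M n) t = cell (M n) z.
    apply/eqP; rewrite eqn_leq (le_cell _ (ltW zt)) andbT -ltnS.
    by rewrite cell_lt // (le_trans z0 (ltW zt)).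
  have : t <= z.
    apply: (ub_le_sup supX.2); split; first exact: le_trans z0 (ltW zt).
    rewrite -zy; apply: le_trans (staircase_window n z0 (ltW zt)) _.
    by rewrite /window ct big_nat1 (negbTE dead) mul0r addr0.
  by rewrite leNgt zt.
exists z; split=> //; first by apply/eqP; exact: (zalive 0).
by move=> n; have /andP[] := zalive n.+1.
Qed.

End Staircase.

(** * Lower bounds for the dimensions *)

(** Distances are at most 1, so raising the exponent lowers the power. Positivity of [t] makes the
    left side 0 for [x = y], also when [s = 0]. *)
Lemma diam_pow_dist (R : realType) (s t : R) (U : set R) (x y : R) :
  0 <= s -> s <= t -> 0 < t -> (diam U <= 1%:E)%E -> U x -> U y ->
  ((`|x - y| `^ t)%:E <= diam_pow s U)%E.
Proof.
move=> s0 st t0 dU Ux Uy.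
have Uneq : U != set0 by apply/set0P; exists x.
have dist_le : (`|x - y|%:E <= diam U)%E.
  by apply: ereal_sup_ubound; exists x => //; exists y.
rewrite /diam_pow (negbTE Uneq).
move: dU dist_le; case: (diam U) => [d| |] //=.
rewrite !lee_fin => d1 xyd.
have [xy0|xy0] := eqVneq `|x - y| 0.
  by rewrite xy0 powR0 ?powR_ge0 // gt_eqF.
apply: (@le_trans _ _ (`|x - y| `^ s)); last first.
  by apply: ge0_ler_powR; rewrite ?nnegrE ?(le_trans _ xyd).
apply: ger_powR => //; rewrite lt_neqAle eq_sym xy0 normr_ge0 /=.
exact: le_trans d1.
Qed.

(** [F] maps the part of [E] in [U k] into an interval of radius [C] times the weight of [U k].
    These intervals cover []0, 1/2[], which bounds the total weight from below. *)
Lemma hausdorff_measure_holder_image (R : realType) (E : set R) (F : R -> R)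
    (C s t : R) :
  0 < C -> 0 <= s -> s <= t -> 0 < t ->
  (forall x y, E x -> E y -> `|F x - F y| <= C * `|x - y| `^ t) ->
  (forall y, 0 < y < 2^-1 -> exists2 x, E x & F x = y) ->
  hausdorff_measure s E <> 0%E.
Proof.
move=> C0 s0 st t0 holder onto H0.
(* Scale 1 keeps all diameters at most 1. A total weight below [1 / (8 C)] makes the total length of
   the intervals less than [1/4]. *)
have : (hausdorff_premeasure s 1 E < ((8 * C)^-1)%:E)%E.
  apply: (@le_lt_trans _ _ 0%E); last by rewrite lte_fin invr_gt0 mulr_gt0.
  by rewrite -H0; apply: ereal_sup_ubound; exists 1 => /=; rewrite ?ltr01.
move=> /ereal_inf_lt[_ [U [EU dU] <-] small].
have dp_fin k : diam_pow s (U k) = (fine (diam_pow s (U k)))%:E.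
  rewrite /diam_pow; case: ifPn => // Uneq; rewrite fineK // fin_num_poweR //.
  move/set0P: Uneq => [x Ux].
  have : (`|x - x|%:E <= diam (U k))%E by apply: ereal_sup_ubound; exists x => //; exists x.
  by move: (dU k); case: (diam (U k)) => [d| |] //=; rewrite ?leye_eq ?leeNy_eq.
pose r k := C * fine (diam_pow s (U k)).
have dp0 k : (0 <= diam_pow s (U k))%E.
  by rewrite /diam_pow; case: ifP => // _; exact: poweR_ge0.
have r0 k : 0 <= r k by rewrite mulr_ge0 ?(ltW C0) ?fine_ge0.
have /choice[c cP] : forall k, exists c, forall x, E x -> U k x -> `|F x - c| <= r k.
  move=> k; have [[z [Ez Uz]]|no] := pselect (exists z, E z /\ U k z).
    exists (F z) => x Ex Ux; apply: le_trans (holder _ _ Ex Ez) _.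
    rewrite ler_pM2l // -lee_fin -dp_fin.
    by apply: diam_pow_dist => //.
  by exists 0 => x Ex Ux; exfalso; apply: no; exists x.
have cover : (`]0, 2^-1[ : set R) `<=` \bigcup_k `[c k - r k, c k + r k]%classic.
  move=> y; rewrite /= in_itv /= => /onto[x Ex <-].
  have [k _ Ux] := EU x Ex.
  exists k => //=; rewrite in_itv /=.
  by have := cP k x Ex Ux; rewrite ler_distl.
have : (lebesgue_measure (`]0%R, 2^-1%R[%classic : set R) <=
    \sum_(0 <= k <oo)
      lebesgue_measure (`[(c k - r k)%R, (c k + r k)%R]%classic : set R))%E.
  by apply: measure_sigma_subadditive => // *; exact: measurable_itv.
rewrite lebesgue_measure_itv /= lte_fin invr_gt0 ltr0n /= oppr0 adde0.
apply/negP; rewrite -ltNge.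
apply: (@le_lt_trans _ _ (\sum_(0 <= k <oo) ((2 * C)%:E * diam_pow s (U k))%E)%E).
  apply: lee_nneseries => [k _ _|k _]; first exact: measure_ge0.
  rewrite lebesgue_measure_itv /= lte_fin.
  rewrite dp_fin -EFinM -EFinB; case: ifP => _; rewrite lee_fin;
    last by rewrite ?mulr_ge0 ?fine_ge0 ?(ltW C0).
  by rewrite -mulrA -/(r k); lra.
rewrite nneseriesZl; last by move=> i _.
apply: (@lt_le_trans _ _ ((2 * C)%:E * ((8 * C)^-1)%:E)%E).
  by rewrite lte_pmul2l // lte_fin mulr_gt0.
rewrite -EFinM lee_fin.
have -> : 2 * C / (8 * C) = 4^-1 by field; rewrite gt_eqF.
by rewrite lef_pV2 ?posrE // ler_nat.
Qed.

Lemma hausdorff_dim_ge (R : realType) (E : set R) (c : R) :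
  (forall s, 0 <= s -> s < c -> hausdorff_measure s E <> 0%E) ->
  (c%:E <= hausdorff_dim E)%E.
Proof.
move=> pos; apply: le_ereal_inf_tmp => _ [s [s0 Hs] <-].
by rewrite lee_fin leNgt; apply/negP => sc; exact: (pos s).
Qed.

(** * Covering numbers and Minkowski dimension *)

Lemma covering_number_le (R : realType) (E : set R) (b d : R) :
  0 <= b -> E `<=` `[0, b] -> 0 < d -> d <= 1 ->
  (covering_number E d <= ((b + 1) / d)%:E)%E.
Proof.
move=> b0 Eb d0 d1; apply: ge_ereal_inf.
pose n := (Num.truncn (b / d)).+1.
exists n%:R%:E; last first.
  rewrite lee_fin -natr1 mulrDl lerD //; last by rewrite div1r invr_ge1 ?unitfE ?gt_eqF.
  by rewrite truncn_le divr_ge0 // ltW.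
exists n => //; exists (fun i => i%:R * d) => x /Eb.
rewrite /= in_itv /= => /andP[x0 xb].
have xd0 : 0 <= x / d by rewrite divr_ge0 // ltW.
have xn : (Num.truncn (x / d) < n)%N.
  by rewrite ltnS; apply: le_truncn; rewrite ler_pM2r ?invr_gt0.
exists (Ordinal xn) => /=.
have /andP[] := truncn_itv xd0; rewrite ler_pdivlMr // ltr_pdivrMr // -natr1 mulrDl.
by move=> -> /ltW; rewrite mul1r.
Qed.

(** A finite union of closed intervals is closed, so if it covers a dense subset of [[0, a[] it
    covers []0, a[], and its length is at least [a]. *)
Lemma covering_number_ge (R : realType) (E : set R) (a d : R) :
  (forall x y, 0 <= x -> x < y -> y < a -> exists2 z, E z & x <= z < y) ->
  0 < d -> ((a / d)%:E <= covering_number E d)%E.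
Proof.
move=> dense d0; apply: le_ereal_inf_tmp => _ [n [c Ec] <-].
rewrite lee_fin ler_pdivrMr //.
have [a0|a0] := leP a 0; first by rewrite (le_trans a0) // mulr_ge0 // ltW.
pose F k : set R := if insub k is Some i then `[c i, c i + d]%classic else set0.
have mF k : measurable (F k) by rewrite /F; case: insubP.
have cover : (`]0, a[%classic : set R) `<=` \big[setU/set0]_(k < n) F k.
  move=> y; rewrite /= in_itv /= => /andP[y0 ya].
  rewrite -bigcup_mkord; apply: contrapT => yF.
  have yc i : ~~ (c i <= y <= c i + d).
    apply/negP => yi; apply: yF; exists (val i) => //=.
    by rewrite /F valK /= in_itv.
  (* The nearest left endpoint beyond [y], capped at [(y + a) / 2]: if [y] is uncovered, so is all
     of [[y, m[]. *)
  pose m := \big[Order.min/(y + a) / 2]_(i | y < c i) c i.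
  have ym : y < m by apply: lt_bigmin => //; lra.
  have ma : m < a.
    by apply: le_lt_trans (bigmin_le_id _ _ _ _) _; lra.
  have [z Ez /andP[yz zm]] := dense _ _ (ltW y0) ym ma.
  have [i /andP[ciz zci]] := Ec z Ez.
  have := yc i; rewrite negb_and -!ltNge => /orP[yci|]; last by lra.
  have := @bigmin_le_cond _ _ _ ((y + a) / 2) i (fun j => y < c j) c yci; rewrite -/m; lra.
have : (lebesgue_measure (`]0%R, a[%classic : set R) <=
    \sum_(k < n) lebesgue_measure (F k))%E.
  by apply: content_subadditive => [k _| |]; [exact: mF|exact: measurable_itv|].
rewrite lebesgue_measure_itv /= lte_fin a0 oppr0 adde0.
move=> /le_trans h; rewrite -lee_fin; apply: h.
apply: (@le_trans _ _ (\sum_(k < n) d%:E)%E).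
  apply: lee_sum => k _; rewrite /F; case: insubP => [i _ _|_]; last first.
    by rewrite measure0 lee_fin ltW.
  rewrite lebesgue_measure_itv /= lte_fin; case: ifP => _; last by rewrite lee_fin ltW.
  by rewrite -EFinB lee_fin; lra.
by rewrite sumEFin lee_fin sumr_const card_ord mulr_natl.
Qed.

Lemma ln_div_cvg1 (R : realType) (K : R) : 0 < K ->
  ((ln (K / d) * (- ln d)^-1)%:E) @[d --> 0^'+] --> 1%E.
Proof.
move=> K0; apply/cvg_EFin; first by near=> d.
have lnpos : \forall d \near (0:R)^'+, 0 < - ln d.
  near=> d; rewrite oppr_gt0; apply: ln_lt0; apply/andP; split; near: d.
    exact: nbhs_right_gt.
  exact: nbhs_right_lt.
have inv0 : (- ln d)^-1 @[d --> (0:R)^'+] --> (0:R).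
  by apply/(gtr0_cvgV0 lnpos); have /cvgNry := @lnNy R.
apply: (@cvg_trans _ (1 + ln K * (- ln d)^-1 @[d --> (0:R)^'+])).
  apply: near_eq_cvg; near=> d => /=.
  have d0 : 0 < d by near: d; exact: nbhs_right_gt.
  have l0 : 0 < - ln d by near: d.
  rewrite lnM ?posrE ?invr_gt0 // lnV ?posrE // mulrDl mulfV ?gt_eqF //.
  by rewrite addrC.
have h : 1 + ln K * (- ln d)^-1 @[d --> (0:R)^'+] --> 1 + ln K * 0.
  by apply: cvgD; [exact: cvg_cst|apply: cvgM => //; exact: cvg_cst].
by rewrite mulr0 addr0 in h.
Unshelve. all: by end_near.
Qed.

Lemma minkowski_dim1 (R : realType) (E : set R) (a b : R) : 0 < a -> 0 <= b ->
  E `<=` `[0, b] ->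
  (forall x y, 0 <= x -> x < y -> y < a -> exists2 z, E z & x <= z < y) ->
  has_minkowski_dim E 1.
Proof.
move=> a0 b0 Eb dense.
apply: (@squeeze_cvge _ _ _ _ (fun d => (ln (a / d) * (- ln d)^-1)%:E) _
  (fun d => (ln ((b + 1) / d) * (- ln d)^-1)%:E)); last 2 first.
- exact: ln_div_cvg1.
- by apply: ln_div_cvg1; lra.
near=> d => /=.
have d0 : 0 < d by near: d; exact: nbhs_right_gt.
have d1 : d < 1 by near: d; exact: nbhs_right_lt.
have l0 : 0 < - ln d by rewrite oppr_gt0 ln_lt0 // d0.
have := covering_number_ge dense d0.
have := covering_number_le b0 Eb d0 (ltW d1).
case: (covering_number E d) => [r| |] //=; rewrite ?leye_eq ?leeNy_eq //.
rewrite !lee_fin => rb ar.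
have ad0 : 0 < a / d by rewrite divr_gt0.
have r0 : 0 < r by apply: lt_le_trans ar.
rewrite (leNgt r 0) r0 -EFinM !lee_fin !ler_pM2r ?invr_gt0 //.
have Kb0 : 0 < (b + 1) / d by rewrite divr_gt0 //; lra.
by apply/andP; split; rewrite ler_ln ?posrE.
Unshelve. all: by end_near.
Qed.

(** * Calculus on the cube *)

Section Calculus.
Variables (R : realType) (v : nat) (eta : R).
Hypothesis eta_gt0 : 0 < eta.
Implicit Types (g : 'rV[R]_v -> R) (x y : 'rV[R]_v) (i : 'I_v).

Lemma is_CnW (K : set 'rV[R]_v) (n : nat) (g : 'rV[R]_v -> R) :
  is_Cn K n.+1 g -> is_Cn K n g.
Proof.
elim: n g => [|n IH] g [gc gp]; first by split.
by split=> // i; have [gi gic] := gp i; split=> //; exact: IH.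
Qed.

Lemma is_Cn_foldr_partial (K : set 'rV[R]_v) (s : seq 'I_v) (n : nat) g :
  is_Cn K (size s + n)%N g -> is_Cn K n (foldr (partial K) g s).
Proof.
elim: s n => [|i s IH] n //; rewrite [size _]/= addSnnS => /IH[_ gp].
exact: (gp i).2.
Qed.

Definition upd x i (t : R) : 'rV[R]_v := x + (t - x ord0 i) *: delta_mx ord0 i.

Lemma updE x i t j : upd x i t ord0 j = if j == i then t else x ord0 j.
Proof.
rewrite !mxE eqxx /=; case: eqP => [->|_]; last by rewrite mulr0 addr0.
by rewrite mulr1 addrC subrK.
Qed.

Lemma updD x i t h : upd x i t + h *: delta_mx ord0 i = upd x i (h + t).
Proof. by rewrite /upd -addrA -scalerDl; congr (_ + _ *: _); ring. Qed.

Lemma upd_id x i : upd x i (x ord0 i) = x.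
Proof. by rewrite /upd subrr scale0r addr0. Qed.

Lemma cube_upd x i t : cube eta x -> 0 <= t <= eta -> cube eta (upd x i t).
Proof. by move=> cx ct j; rewrite updE; case: eqP. Qed.

Lemma upd_continuous x i : continuous (upd x i).
Proof.
move=> t; apply: cvgD; first exact: cvg_cst.
apply: cvgZr_tmp; apply: cvgB; [exact: cvg_id|exact: cvg_cst].
Qed.

Lemma cube_compact : compact (cube eta : set 'rV[R]_v).
Proof.
have -> : cube eta = [set x : 'rV[R]_v | forall i, `[0, eta]%classic (x ord0 i)].
  by apply/seteqP; split=> x cx i; have := cx i; rewrite /= in_itv.
by apply: (@rV_compact R v (fun=> `[0, eta]%classic)) => i; exact: segment_compact.
Qed.

Lemma cube_neq0 : (cube eta : set 'rV[R]_v) !=set0.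
Proof. by exists 0 => i; rewrite mxE lexx ltW. Qed.

Lemma cube_ub g : {within cube eta, continuous g} ->
  exists2 C, 0 < C & forall x, cube eta x -> `|g x| <= C.
Proof.
move=> gc.
have nc : {within cube eta, continuous (fun x => `|g x|)}.
  by move=> x; apply: continuous_comp; [exact: gc|exact: norm_continuous].
have [z _ zmax] := compact_EVT_max cube_neq0 cube_compact nc.
exists (`|g z| + 1) => [|x cx]; first by rewrite ltr_wpDl.
by rewrite (le_trans (zmax x _)) ?inE // lerDl.
Qed.

Lemma cube_lb g : {within cube eta, continuous g} ->
  (forall x, cube eta x -> g x <> 0) ->
  exists2 c, 0 < c & forall x, cube eta x -> c <= `|g x|.
Proof.
move=> gc g0.
have nc : {within cube eta, continuous (fun x => `|g x|)}.
  by move=> x; apply: continuous_comp; [exact: gc|exact: norm_continuous].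
have [z zc zmin] := compact_EVT_min cube_neq0 cube_compact nc.
exists `|g z| => [|x cx]; last by apply: zmin; rewrite inE.
by rewrite normr_gt0; apply/eqP/g0; rewrite inE in zc.
Qed.

(** For [0 < t < eta] small increments of both signs stay in the cube, so [increments] is the full
    punctured neighbourhood filter and [partial] an ordinary derivative. *)
Lemma upd_is_derive g x i t : is_Cn (cube eta) 1 g -> cube eta x ->
  0 < t < eta ->
  is_derive t 1 (fun u => g (upd x i u)) (partial (cube eta) i g (upd x i t)).
Proof.
move=> [_ gp] cx /andP[t0 teta].
have ct : cube eta (upd x i t) by apply: cube_upd; rewrite // !ltW.
have [/(_ _ ct)] := gp i; rewrite /has_partial /partial.
have -> : increments (cube eta) i (upd x i t) = 0^'.
  have near_cube : \forall h \near (0 : R)^',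
      cube eta (upd x i t + h *: delta_mx ord0 i).
    have : \forall h \near (0 : R), 0 < h + t < eta.
      have hc : (h + t) @[h --> (0 : R)] --> 0 + t.
        by apply: cvgD; [exact: cvg_id|exact: cvg_cst].
      rewrite add0r in hc.
      near=> h; apply/andP; split; near: h.
        by apply: (cvgr_gt _ hc).
      by apply: (cvgr_lt _ hc).
    apply: filterS => h /andP[h0 h1] _.
    by rewrite updD; apply: cube_upd; rewrite // !ltW.
  apply/seteqP; split=> A; rewrite /increments /within /=.
    by apply: filterS2 near_cube => h ch; apply.
  by apply: filterS => h Ah _.
have -> : diff_quotient i g (upd x i t) =
   (fun h => h^-1 *: (((fun u => g (upd x i u)) \o shift t) (h *: 1) - g (upd x i t))).
  by apply/funext => h; rewrite /diff_quotient updD /= /shift /= scaler1.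
by move=> gd _; apply: DeriveDef.
Unshelve. all: by end_near.
Qed.

Lemma partial_MVT g x i a b : is_Cn (cube eta) 1 g -> cube eta x ->
  0 <= a -> a < b -> b <= eta ->
  exists2 c, a < c < b &
    g (upd x i b) - g (upd x i a) = partial (cube eta) i g (upd x i c) * (b - a).
Proof.
move=> gC cx a0 ab beta.
have der t : t \in `]a, b[ -> is_derive t 1 (fun u => g (upd x i u))
    (partial (cube eta) i g (upd x i t)).
  rewrite in_itv /= => /andP[at_ tb]; apply: upd_is_derive => //.
  by rewrite (le_lt_trans a0) // (lt_le_trans tb).
have cont : {within `[a, b], continuous (fun u => g (upd x i u))}.
  apply/subspace_continuousP => t; rewrite /= in_itv /= => /andP[at_ tb].
  have ct : cube eta (upd x i t).
    by apply: cube_upd => //; rewrite (le_trans a0) // (le_trans tb).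
  have gct := (subspace_continuousP _ _).1 gC.1 _ ct.
  have uw : upd x i u @[u --> within `[a, b]%classic (nbhs t)] -->
      within (cube eta) (nbhs (upd x i t)).
    move=> A nA.
    have nA' : nbhs t (fun u => cube eta (upd x i u) -> A (upd x i u)).
      exact: (@upd_continuous x i t _ nA).
    rewrite /fmap /within /=; apply: filterS nA' => u uA.
    rewrite in_itv /= => /andP[au ub].
    by apply: uA; apply: cube_upd => //; rewrite (le_trans a0) // (le_trans ub).
  exact: (cvg_comp _ g uw gct).
have [c cab e] := MVT ab der cont.
by exists c; rewrite // in_itv in cab.
Qed.

Lemma partial_expansion g x i a b c : is_Cn (cube eta) 1 g -> cube eta x ->
  0 <= a -> a <= b -> b <= eta ->
  (forall t, a <= t <= b -> c <= `|partial (cube eta) i g (upd x i t)|) ->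
  c * (b - a) <= `|g (upd x i b) - g (upd x i a)|.
Proof.
move=> gC cx a0; rewrite le_eqVlt => /predU1P[-> _ _|ab beta lb].
  by rewrite !subrr mulr0 normr0.
have [t /andP[at_ tb] ->] := partial_MVT i gC cx a0 ab beta.
rewrite normrM (gtr0_norm (x := b - a)) ?subr_gt0 // ler_pM2r ?subr_gt0 //.
by apply: lb; rewrite !ltW.
Qed.

(** The coordinates of [x] are replaced by those of [y] one at a time, each replacement being
    controlled by the mean value theorem. *)
Lemma lipschitz_cube g : is_Cn (cube eta) 1 g ->
  exists2 C, 0 < C & forall x y d, cube eta x -> cube eta y ->
    0 <= d -> (forall i, `|x ord0 i - y ord0 i| <= d) -> `|g x - g y| <= C * d.
Proof.
move=> gC.
have /choice[B Bub] : forall i, exists B, 0 < B /\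
    forall x, cube eta x -> `|partial (cube eta) i g x| <= B.
  move=> i; have [gpi [gpic _]] := gC.2 i.
  by have [B B0 Bub] := cube_ub gpic; exists B.
pose C0 := \sum_i B i.
have BC i : B i <= C0.
  by rewrite /C0 (bigD1 i) //= lerDl sumr_ge0 // => j _; exact: ltW (Bub j).1.
have C00 : 0 <= C0 by apply: sumr_ge0 => i _; exact: ltW (Bub i).1.
have step x i a b : cube eta x -> 0 <= a <= eta -> 0 <= b <= eta ->
    `|g (upd x i b) - g (upd x i a)| <= C0 * `|b - a|.
  wlog ab : a b / a <= b.
    move=> H cx ha hb; have [|/ltW ba] := leP a b; first by move/H; exact.
    by rewrite distrC (distrC b); exact: H.
  move=> cx /andP[a0 _] /andP[_ b1]; move: ab.
  rewrite le_eqVlt => /predU1P[->|ab]; first by rewrite !subrr !normr0 mulr0.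
  have [t /andP[at_ tb] ->] := partial_MVT i gC cx a0 ab b1.
  rewrite normrM ler_wpM2r //; apply: le_trans (BC i); apply: (Bub i).2.
  by apply: cube_upd => //; rewrite (le_trans a0 (ltW at_)) (le_trans (ltW tb)).
exists (C0 * v%:R + 1) => [|x y d cx cy d0 xyd]; first by rewrite ltr_wpDl ?mulr_ge0.
pose z k : 'rV[R]_v := \row_j (if (j < k)%N then y ord0 j else x ord0 j).
have cz k : cube eta (z k) by move=> j; rewrite mxE; case: ifP.
have zS k (kv : (k < v)%N) : z k.+1 = upd (z k) (Ordinal kv) (y ord0 (Ordinal kv)).
  apply/rowP => j; rewrite updE !mxE -(inj_eq val_inj) /= ltnS leq_eqVlt.
  by case: eqP => //= jk; congr (y _ _); exact: val_inj.
have tele k : (k <= v)%N -> `|g (z k) - g x| <= C0 * d * k%:R.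
  elim: k => [_|k IH kv].
    have -> : z 0%N = x by apply/rowP => j; rewrite mxE.
    by rewrite subrr normr0 mulr0.
  rewrite -natr1 mulrDr mulr1 [leRHS]addrC.
  rewrite -(subrK (g (z k)) (g (z k.+1))) -addrA; apply: le_trans (ler_normD _ _) _.
  apply: lerD; last by apply: IH; exact: ltnW.
  rewrite (zS k kv) -{2}(upd_id (z k) (Ordinal kv)).
  apply: le_trans (step _ _ _ _ (cz k) (cz k _) (cy _)) _.
  by rewrite ler_wpM2l // mxE /= ltnn distrC.
have := tele v (leqnn v).
have -> : z v = y by apply/rowP => j; rewrite mxE ltn_ord.
rewrite distrC => /le_trans; apply.
by rewrite mulrDl mul1r mulrAC lerDl.
Qed.

End Calculus.

(** * One generation of the construction *)

Section Selection.
Local Open Scope nat_scope.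

(* A value [sel u >= L] selects no child of the block [u]; it is what [find]
   returns below when all the children are bad. *)
Definition select (L : nat) (sel : nat -> nat) : pred nat :=
  fun j => j %% L == sel (j %/ L).

Lemma selectE L sel u b : b < L -> select L sel (u * L + b) = (b == sel u).
Proof.
move=> bL; have L0 : 0 < L by exact: leq_ltn_trans bL.
by rewrite /select divnMDl // divn_small // addn0 modnMDl modn_small.
Qed.

Lemma select_one_per_block L sel : one_per_block L (select L sel).
Proof. by move=> u b b' bL b'L; rewrite !selectE // => /eqP -> /eqP ->. Qed.

Lemma select_sum L sel u :
  \sum_(0 <= b < L) select L sel (u * L + b) = (sel u < L).
Proof.
have -> : \sum_(0 <= b < L) select L sel (u * L + b) = \sum_(0 <= b < L) (b == sel u).
  rewrite big_nat_cond [RHS]big_nat_cond; apply: eq_bigr => b /andP[/andP[_ bL] _].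
  by rewrite selectE.
have [h|h] := ltnP (sel u) L.
  rewrite (bigD1_seq (sel u)) ?mem_index_iota ?iota_uniq //= eqxx.
  by rewrite big1 // => b /negbTE ->.
rewrite big_nat_cond big1 // => b /andP[/andP[_ bL] _].
by case: eqP => // e; move: h; rewrite -e leqNgt bL.
Qed.

(** A block is lost only when all its [L] children are bad. So at most [T / L] blocks are lost,
    which is at most [N / e]. *)
Lemma select_find_many (L N k : nat) (sel : nat -> nat) (bad : pred nat) (T e : nat) :
  (forall u, sel u = find (fun b => ~~ bad (u * L + b)) (iota 0 L) \/ sel u < L) ->
  \sum_(0 <= i < N * L) bad (k * (N * L) + i) <= T ->
  e * T <= L * N ->
  0 < L ->
  e * N <= e * (\sum_(0 <= i < N * L) select L sel (k * (N * L) + i)) + N.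
Proof.
move=> selP; rewrite !sum_blocks0 => badT eT L0.
under [X in e * X + _]eq_bigr do under eq_bigr do rewrite mulnA addnA -mulnDl.
under [X in e * X + _]eq_bigr do rewrite select_sum.
move: badT; under eq_bigr do under eq_bigr do rewrite mulnA addnA -mulnDl.
move=> badT.
have full : (\sum_(0 <= a < N) (L <= sel (k * N + a))) * L <= T.
  apply: leq_trans badT; rewrite big_distrl /=; apply: leq_sum => a _.
  case: (leqP L (sel (k * N + a))) => [full|]; last by rewrite mul0n.
  have [selE|] := selP (k * N + a); last by rewrite ltnNge full.
  rewrite mul1n -[leqLHS]muln1 -[X in X * 1]subn0 -sum_nat_const_nat.
  rewrite big_nat_cond [leqRHS]big_nat_cond; apply: leq_sum => b /andP[/andP[_ bL] _].
  have : ~~ has (fun b => ~~ bad ((k * N + a) * L + b)) (iota 0 L).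
    by rewrite has_find size_iota -selE -leqNgt.
  by move=> /hasPn/(_ b); rewrite mem_iota negbK => ->.
have tot : \sum_(0 <= a < N) (sel (k * N + a) < L) +
    \sum_(0 <= a < N) (L <= sel (k * N + a)) = N.
  rewrite -big_split /= -[RHS]muln1 -[X in X * 1]subn0 -sum_nat_const_nat.
  by apply: eq_bigr => a _; case: ltnP.
move: full tot; set F := \sum_(0 <= a < N) (L <= _); set G := \sum_(0 <= a < N) _.
move=> full tot.
have : e * F <= N.
  rewrite -(leq_pmul2r L0) -mulnA [leqRHS]mulnC; apply: leq_trans eT.
  by rewrite leq_mul2l full orbT.
have h : e * N = e * G + e * F by rewrite -mulnDr tot.
by rewrite h leq_add2l.
Qed.

End Selection.

(** * Keeping one function away from zero by one refinement *)

Section Refinement.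
Variables (R : realType) (p : nat) (eta : R).
Hypothesis eta_gt0 : 0 < eta.

(** Here [v = p.+2], so [p.+1] coordinates differ from [i]. [D l] describes the cells allowed for
    coordinate [l]; those of [i] are disjoint from the others, so that their children can be chosen
    freely while the others take first children. *)
Lemma refinement_step (n M0 B : nat) (g : 'rV[R]_p.+2 -> R) (i : 'I_p.+2)
    (D : 'I_p.+2 -> nat -> Prop) (c : R) :
  (0 < M0)%N -> (M0%:R)^-1 <= eta -> (0 < B)%N ->
  is_Cn (cube eta) 1 g ->
  (forall l k, l != i -> D l k -> ~ D i k) ->
  0 < c ->
  (forall x : 'rV[R]_p.+2,
    (forall l, 0 <= x ord0 l < (M0%:R)^-1 /\ D l (cell (M0 * B) (x ord0 l))) ->
    c <= `|partial (cube eta) i g x|) ->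
  exists N L S, [/\ (1 < N)%N, (0 < L)%N, one_per_block L S,
    forall k, (2 ^ n.+2 * N <=
      2 ^ n.+2 * (\sum_(0 <= j < N * L) S (k * (N * L) + j)%N) + N)%N &
    ((M0 * B * (N * L)) ^ n.+1 <= N ^ (p.+1 * n.+1).+1)%N] /\
  exists2 c', 0 < c' & forall x : 'rV[R]_p.+2,
    (forall l, [/\ 0 <= x ord0 l < (M0%:R)^-1, D l (cell (M0 * B) (x ord0 l)) &
                S (cell (M0 * B * (N * L)) (x ord0 l))]) ->
    c' <= `|g x|.
Proof.
move=> M0_gt0 M0eta B_gt0 gC Ddisj c_gt0 glb.
have [C C_gt0 gLip] := lipschitz_cube eta_gt0 gC.
(* [A0] bounds the spread of the bad children for fixed cells of the other coordinates, [kappa]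
   makes [2 ^ n.+2 * A0 * (B * N) ^ p.+1] equal to [L * N], and [N] absorbs [(M * kappa) ^ n.+1]. *)
pose A0 := (Num.truncn ((2 + C) / c)).+2.
pose kappa := (A0 * B ^ p.+1 * 2 ^ n.+2)%N.
pose M := (M0 * B)%N.
pose N := ((M * kappa) ^ n.+1 + 2)%N.
pose L := (kappa * N ^ p)%N.
have M_gt0 : (0 < M)%N by rewrite muln_gt0 M0_gt0.
have N_gt1 : (1 < N)%N by rewrite /N addn2.
have N_gt0 : (0 < N)%N by rewrite ltnW.
have kappa_gt0 : (0 < kappa)%N.
  by rewrite /kappa 2!muln_gt0 expn_gt0 B_gt0 expn_gt0.
have L_gt0 : (0 < L)%N by rewrite /L muln_gt0 kappa_gt0 expn_gt0 N_gt0.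
have MN_gt0 : (0 < M * N)%N by rewrite muln_gt0 M_gt0.
have NL_gt0 : (0 < N * L)%N by rewrite muln_gt0 N_gt0.
pose M' := (M * (N * L))%N.
have M'_gt0 : (0 < M')%N by rewrite muln_gt0 M_gt0.
have M'E : M' = (M * N * L)%N by rewrite /M' mulnA.
pose d : R := (M'%:R)^-1.
have d_gt0 : 0 < d by rewrite invr_gt0 ltr0n.
pose dom (x : 'rV[R]_p.+2) :=
  forall l, 0 <= x ord0 l < (M0%:R)^-1 /\ D l (cell M (x ord0 l)).
have dom_cube x : dom x -> cube eta x.
  move=> dx l; have [/andP[-> h] _] := dx l.
  by rewrite /= (le_trans (ltW h)).
(* A child is bad if [|g|] can be less than [d] in it while the other coordinates lie in first
   children. *)
pose Bad j := exists x : 'rV[R]_p.+2, [/\ dom x,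
  forall l, l != i -> (cell M' (x ord0 l) %% L)%N = 0%N,
  cell M' (x ord0 i) = j & `|g x| < d].
pose bad j := `[< Bad j >].
(* [u %/ N] is the parent of block [u]: a good child is sought in the cells of coordinate [i], the
   first child is taken elsewhere. *)
pose sel u := if `[< D i (u %/ N)%N >]
  then find (fun b => ~~ bad (u * L + b)%N) (iota 0 L) else 0%N.
(* [g] grows at rate [c] along [i], moves by at most [C * d] when the other
   coordinates stay in their cells, and is below [d] at both witnesses. *)
have close x y : dom x -> dom y -> `|g x| < d -> `|g y| < d ->
    (forall l, l != i -> cell M' (x ord0 l) = cell M' (y ord0 l)) ->
    cell M (x ord0 i) = cell M (y ord0 i) ->
    x ord0 i <= y ord0 i ->
    (cell M' (y ord0 i) < cell M' (x ord0 i) + A0)%N.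
  move=> dx dy gx gy xyl xyi lexy.
  have cx := dom_cube _ dx; have cy := dom_cube _ dy.
  have x0 l : 0 <= x ord0 l by have [/andP[]] := dx l.
  have y0 l : 0 <= y ord0 l by have [/andP[]] := dy l.
  (* From [x] to [z] only the Lipschitz error occurs, from [z] to [y] only the growth along [i]. *)
  pose z := upd y i (x ord0 i).
  have cz : cube eta z by apply: cube_upd; rewrite ?cx.
  have xz : `|g x - g z| <= C * d.
    apply: gLip => //; first exact: ltW.
    move=> l; rewrite updE; have [->|li] := eqVneq l i; first by rewrite subrr normr0 ltW.
    have := cell_itv M'_gt0 (x0 l); have := cell_itv M'_gt0 (y0 l).
    rewrite (xyl _ li) -natr1 mulrDl mul1r -/d ler_norml.
    by move: (_ / _) => q /andP[q1 q2] /andP[q3 q4]; apply/andP; split; lra.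
  have yz : c * (y ord0 i - x ord0 i) <= `|g y - g z|.
    have := @partial_expansion _ _ _ g y i (x ord0 i) (y ord0 i) c gC cy.
    rewrite upd_id; apply=> //; first by have /andP[] := cy i.
    move=> t /andP[xt ty]; apply: glb => l; rewrite updE.
    case: eqP => [->|_]; last exact: dy.
    have [/andP[_ yM] Dy] := dy i.
    split; first by rewrite (le_trans (x0 i) xt) (le_lt_trans ty).
    rewrite (_ : cell _ t = cell M (y ord0 i)) //.
    by apply/eqP; rewrite eqn_leq (le_cell M ty) -xyi (le_cell M xt).
  have : c * (y ord0 i - x ord0 i) <= (2 + C) * d.
    apply: (le_trans yz); rewrite (_ : g y - g z = g y - g x + (g x - g z)); last by ring.
    apply: (le_trans (ler_normD _ _)); rewrite mulrDl; apply: lerD => //.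
    by apply: (le_trans (ler_normB _ _)); lra.
  rewrite mulrC -ler_pdivlMr // => h.
  have := cell_itv M'_gt0 (x0 i); have := cell_itv M'_gt0 (y0 i).
  move=> /andP[+ _] /andP[_ +].
  rewrite -/d => hy hx.
  have A0lt : (2 + C) / c + 1 < A0%:R.
    by rewrite /A0 -[ltRHS]natr1 ltrD2r; exact: truncnS_gt.
  move: h A0lt; rewrite mulrAC; move: ((2 + C) / c) => K h A0lt.
  have A0d : K * d + d < A0%:R * d.
    by rewrite -[X in _ + X]mul1r -mulrDl ltr_pM2r.
  rewrite -(ltr_nat R) natrD -(ltr_pM2r d_gt0) mulrDl.
  move: hx; rewrite -natr1 mulrDl mul1r.
  by lra.
have card_bad k : (\sum_(0 <= j < N * L) bad (k * (N * L) + j) <= A0 * (B * N) ^ p.+1)%N.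
  rewrite big_mkord.
  have -> : (\sum_(a < N * L) bad (k * (N * L) + a) =
      #|[set a : 'I_(N * L) | bad (k * (N * L) + a)%N]%SET|)%N.
    by rewrite -sum1dep_card [RHS]big_mkcond; apply: eq_bigr => a _; case: (bad _).
  have BN_gt0 : (0 < B * N)%N by rewrite muln_gt0 B_gt0.
  have /choice[w wP] : forall a : 'I_(N * L), exists x : 'rV[R]_p.+2,
      bad (k * (N * L) + a)%N -> [/\ dom x,
      forall l, l != i -> (cell M' (x ord0 l) %% L)%N = 0%N,
      cell M' (x ord0 i) = (k * (N * L) + a)%N & `|g x| < d].
    move=> a; case b: (bad _); last by exists 0.
    by move/asboolP: b => [x xP]; exists x.
  (* A bad child is determined by the blocks of the other coordinates of its witness and by its
     index modulo [A0], since bad children with the same blocks are less than [A0] apart. *)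
  pose phi (a : 'I_(N * L)) : {ffun 'I_p.+1 -> 'I_(B * N).-1.+1} * 'I_A0 :=
    ([ffun l => inord (cell (M * N) (w a ord0 (lift i l)))], inord (a %% A0)).
  rewrite -(@card_in_imset _ _ phi); last first.
    move=> a b; rewrite !finset.in_set => ba bb [] /ffunP e1 /(congr1 val) /=.
    rewrite !inordK ?ltn_mod // => e2.
    have [da za ca ga] := wP a ba; have [db zb cb gb] := wP b bb.
    have same l : l != i -> cell M' (w a ord0 l) = cell M' (w b ord0 l).
      move=> li; have [j ->] : exists j, l = lift i j.
        by case: (unliftP i l) li => [j ->|->]; [exists j|rewrite eqxx].
      have := congr1 (@nat_of_ord _) (e1 j); rewrite !ffunE.
      have lt_BN (x : 'rV[R]_p.+2) : dom x ->
          (cell (M * N) (x ord0 (lift i j)) < (B * N).-1.+1)%N.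
        move=> dx; have [/andP[h1 h2] _] := dx (lift i j).
        rewrite prednK // cell_lt ?MN_gt0 //.
        rewrite (_ : _ / _ = (M0%:R)^-1) // /M !natrM.
        by field; rewrite !pnatr_eq0 -!lt0n M0_gt0 B_gt0 N_gt0.
      rewrite !inordK ?lt_BN // => e3.
      have zi : lift i j != i by rewrite eq_sym neq_lift.
      rewrite (divn_eq (cell M' (w a _ _)) L) (divn_eq (cell M' (w b _ _)) L).
      have [/andP[h1 _] _] := da (lift i j); have [/andP[h2 _] _] := db (lift i j).
      by rewrite za // zb // M'E !(cell_divn MN_gt0 L_gt0) // e3.
    have samei : cell M (w a ord0 i) = cell M (w b ord0 i).
      have [/andP[h1 _] _] := da i; have [/andP[h2 _] _] := db i.
      rewrite -!(@cell_divn _ M (N * L)) // -/M' ca cb.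
      by rewrite !divnMDl // !divn_small.
    apply: val_inj => /=.
    wlog lab : a b ba bb e1 e2 da za ca ga db zb cb gb same samei /
        w a ord0 i <= w b ord0 i.
      move=> H; have [h|/ltW h] := leP (w a ord0 i) (w b ord0 i); first exact: (H a b).
      by apply/esym/(H b a) => // l li; rewrite same.
    have := close _ _ da db ga gb same samei lab.
    have := le_cell M' lab; rewrite ca cb -addnA ltn_add2l leq_add2l.
    move=> le_ab lt_ab.
    have := e2; rewrite -(subnKC le_ab).
    move: (b - a)%N (subnKC le_ab) => t tE.
    rewrite -{1}(addn0 (val a)) => /eqP; rewrite eqn_modDl mod0n modn_small.
      by move/eqP <-; rewrite addn0.
    by move: lt_ab; rewrite -tE ltn_add2l.
  apply: leq_trans (max_card _) _.
  by rewrite card_prod card_ffun !card_ord prednK // mulnC.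
exists N, L, (select L sel); split; first split=> //.
- exact: select_one_per_block.
- move=> k; apply: (@select_find_many _ _ _ _ bad _ _ _ (card_bad k)) => //.
    by move=> u; rewrite /sel; case: ifP => _; [left|right].
  by rewrite /L /kappa expnMn (expnS N); apply: eq_leq; ring.
- rewrite /L -/M.
  have -> : (M * (N * (kappa * N ^ p)) = M * kappa * N ^ p.+1)%N by rewrite expnS; ring.
  rewrite expnMn -expnM [leqRHS]expnS leq_mul2r; apply/orP; right.
  by rewrite /N leq_addr.
exists d => // x xP.
have dx : dom x by move=> l; have [] := xP l.
have x0 l : 0 <= x ord0 l by have [/andP[]] := dx l.
rewrite leNgt; apply/negP => gx.
have selx l : (cell M' (x ord0 l) %% L = sel (cell (M * N) (x ord0 l)))%N.
  have [_ _ /eqP] := xP l; rewrite -/M -/M' => ->.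
  by rewrite M'E (cell_divn MN_gt0 L_gt0).
have cMN l : (cell (M * N) (x ord0 l) %/ N)%N = cell M (x ord0 l) by rewrite cell_divn.
(* The other coordinates avoid the cells of [D i], hence lie in first children. So [x] makes its own
   child bad, against the selection of a good one. *)
have xbad : bad (cell M' (x ord0 i)).
  apply/asboolP; exists x; split=> // l li.
  rewrite selx /sel cMN; case: asboolP => // Di; exfalso.
  by apply: (Ddisj _ _ li _ Di); exact: (dx l).2.
have := ltn_pmod (cell M' (x ord0 i)) L_gt0.
have := selx i; rewrite /sel cMN; case: asboolP => [_ e|]; last by move=> /(_ (dx i).2).
rewrite e => lt_find.
have := nth_find 0%N (s := iota 0 L)
  (a := fun b => ~~ bad (cell (M * N) (x ord0 i) * L + b)%N).
rewrite has_find size_iota => /(_ lt_find).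
rewrite nth_iota // add0n -e.
rewrite -(cell_divn MN_gt0 L_gt0) // -M'E -divn_eq.
by rewrite xbad.
Qed.

End Refinement.

(** * The avoiding set *)

(* The last condition is an integer form of [(M N L)^s <= N] with
   [s = (n + 1) / ((p + 1) (n + 1) + 1)], which tends to [1 / (p + 1)]. *)
Lemma flat_step (n M p : nat) : (0 < M)%N ->
  exists N L S, [/\ (1 < N)%N, (0 < L)%N, one_per_block L S,
    forall k, (2 ^ n.+2 * N <=
      2 ^ n.+2 * (\sum_(0 <= j < N * L) S (k * (N * L) + j)%N) + N)%N &
    ((M * (N * L)) ^ n.+1 <= N ^ (p.+1 * n.+1).+1)%N].
Proof.
move=> M_gt0; pose N := (M ^ n.+1 + 2)%N.
have N_gt1 : (1 < N)%N by rewrite /N addn2.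
have L_gt0 : (0 < N ^ p)%N by rewrite expn_gt0 ltnW.
exists N, (N ^ p)%N, (select (N ^ p) (fun=> 0%N)); split=> //.
- exact: select_one_per_block.
- move=> k; apply: (@select_find_many _ _ _ _ pred0 0) => //; first by right.
    by rewrite big1.
  by rewrite muln0.
rewrite -expnS expnMn -expnM [leqRHS]expnS leq_mul2r; apply/orP; right.
by rewrite leq_addr.
Qed.

(** Pairing [x] with a dummy integer gives it infinitely many codes; thus every task recurs after
    any given generation. *)
Lemma pickle_unbounded (T : countType) (x : T) (n0 : nat) :
  exists n j, (n0 <= n)%N /\ unpickle n = Some (x, j : nat).
Proof.
apply: contrapT => no.
have small (j : nat) : (pickle (x, j) < n0)%N.
  rewrite ltnNge; apply/negP => le; apply: no.
  by exists (pickle (x, j)), j; rewrite pickleK.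
have inj : injective (fun j : 'I_n0.+1 => Ordinal (small j)).
  move=> j k /(congr1 (@nat_of_ord _)) /= /(pcan_inj pickleK) [].
  exact: val_inj.
by have := leq_card _ inj; rewrite !card_ord ltnn.
Qed.

(** A list of single derivatives allows removing them one at a time. *)
Lemma multi_partial_foldr (R : realType) (v : nat) (K : set 'rV[R]_v)
    (b : 'I_v -> nat) (g : 'rV[R]_v -> R) :
  exists2 s : seq 'I_v, size s = (\sum_(i < v) b i)%N &
    multi_partial K b g = foldr (partial K) g s.
Proof.
exists (flatten [seq nseq (b i) i | i <- enum 'I_v]).
  rewrite size_flatten /shape -map_comp sumnE big_map -[RHS]big_enum /=.
  by apply: eq_bigr => i _; rewrite /= size_nseq.
rewrite /multi_partial; elim: (enum _) => //= i e ->.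
by rewrite foldr_cat; elim: (b i) => //= n ->.
Qed.

Section Construction.
Variables (R : realType) (p : nat) (eta : R).
Hypothesis eta_gt0 : 0 < eta.
Variables (Q : countType) (f : Q -> 'rV[R]_p.+2 -> R) (M0 : nat).
Hypothesis M0_gt0 : (0 < M0)%N.
Hypothesis M0_eta : (M0%:R)^-1 <= eta.

(* [ances m k t] stands for the fact that the cell [k] of the current generation
   has ancestor [t] in generation [m], and that it and all its ancestors in
   the later generations have been selected. *)
Definition lower_bounded (B : nat) (ances : nat -> nat -> nat -> Prop) (m : nat)
    (t : 'I_p.+2 -> nat) (h : 'rV[R]_p.+2 -> R) :=
  exists2 c, 0 < c & forall x : 'rV[R]_p.+2,
    (forall l, 0 <= x ord0 l < (M0%:R)^-1 /\
               ances m (cell (M0 * B) (x ord0 l)) (t l)) -> c <= `|h x|.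

Definition iter_partial (q : Q) (s : seq 'I_p.+2) : 'rV[R]_p.+2 -> R :=
  foldr (partial (cube eta)) (f q) s.

(** The number of cells in [[0, 1/M0[], and the ancestry relation [ances]. *)
Definition state := (nat * (nat -> nat -> nat -> Prop))%type.

(** A cell of the new generation [n.+1] is its own ancestor there; older ancestors are those of its
    parent, provided that the cell is selected. *)
Definition next_state (n : nat) (st : state) (NLS : nat * nat * pred nat) : state :=
  ((st.1 * (NLS.1.1 * NLS.1.2))%N,
   fun m k t => if m == n.+1 then k = t
     else st.2 m (k %/ (NLS.1.1 * NLS.1.2))%N t /\ NLS.2 k).

(** The task [(q, i, s, m, t)] removes the outer derivative [d_i] from [d_i d_s f_q], for points
    whose coordinates descend from the cells [t l] of generation [m]. *)
Definition task := (Q * 'I_p.+2 * seq 'I_p.+2 * nat * {ffun 'I_p.+2 -> nat})%type.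

Definition good_step (n : nat) (st : state) (NLS : nat * nat * pred nat) : Prop :=
  let: (N, L, W) := NLS in
  [/\ (1 < N)%N, (0 < L)%N, one_per_block L W,
    forall k, (2 ^ n.+2 * N <=
      2 ^ n.+2 * (\sum_(0 <= j < N * L) W (k * (N * L) + j)%N) + N)%N &
    ((M0 * st.1 * (N * L)) ^ n.+1 <= N ^ (p.+1 * n.+1).+1)%N] /\
  forall q i s m t (j : nat), unpickle n = Some ((q, i, s, m, t) : task, j) ->
    injective t -> (m <= n)%N ->
    is_Cn (cube eta) 1 (iter_partial q s) ->
    lower_bounded st.1 st.2 m t (iter_partial q (i :: s)) ->
    lower_bounded (next_state n st NLS).1 (next_state n st NLS).2 m t
      (iter_partial q s).

Lemma good_step_exists (n : nat) (st : state) :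
  (0 < st.1)%N -> (forall m k t t', st.2 m k t -> st.2 m k t' -> t = t') ->
  exists NLS, good_step n st NLS.
Proof.
case: st => B A /= B_gt0 Afun.
have M_gt0 : (0 < M0 * B)%N by rewrite muln_gt0 M0_gt0.
have triv : (forall q i s m t (j : nat), unpickle n = Some ((q, i, s, m, t) : task, j) ->
    injective t -> (m <= n)%N -> is_Cn (cube eta) 1 (iter_partial q s) ->
    ~ lower_bounded B A m t (iter_partial q (i :: s))) ->
    exists NLS, good_step n (B, A) NLS.
  move=> no; have [N [L [S NLSP]]] := flat_step n p M_gt0.
  exists (N, L, S); split=> // q i s m t j e tinj mn gC lb.
  by case: (no _ _ _ _ _ _ e tinj mn gC).
case e : (unpickle n : option (task * nat)) => [[[[[[q i] s] m] t] j]|]; last first.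
  by apply: triv => q i s m t j; rewrite e.
have [[tinj mn gC lb]|no] := pselect [/\ injective t, (m <= n)%N,
    is_Cn (cube eta) 1 (iter_partial q s) &
    lower_bounded B A m t (iter_partial q (i :: s))]; last first.
  apply: triv => q' i' s' m' t' j'; rewrite e => -[<- <- <- <- <- _] ? ? ? ?.
  exact: no.
have [c c_gt0 clb] := lb.
(* Ancestors are unique and [t] is injective, so different coordinates have disjoint sets of
   cells. *)
have Ddisj l k : l != i -> A m k (t l) -> ~ A m k (t i).
  by move=> li a1 a2; move: li; rewrite (tinj _ _ (Afun _ _ _ _ a1 a2)) eqxx.
have [N [L [S [[N1 L0 blk many pw] [c' c'0 c'lb]]]]] :=
  refinement_step eta_gt0 n M0_gt0 M0_eta B_gt0 gC Ddisj c_gt0 clb.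
exists (N, L, S); split=> // q' i' s' m' t' j'; rewrite e => -[<- <- <- <- <- _] _ _ _ _.
exists c' => //= x xP; apply: c'lb => l.
have [xl] := xP l; rewrite (ltn_eqF (mn : (m < n.+1)%N)) => -[Ax Sx].
have [x0 _] := andP xl.
have NL_gt0 : (0 < N * L)%N by rewrite muln_gt0 L0 ltnW.
split=> //; first by rewrite mulnA cell_divn in Ax.
by rewrite -mulnA.
Qed.

Variable next : nat * state -> nat * nat * pred nat.
Hypothesis nextP : forall n (st : state), (0 < st.1)%N ->
  (forall m k t t', st.2 m k t -> st.2 m k t' -> t = t') ->
  good_step n st (next (n, st)).

Fixpoint gen (n : nat) : state :=
  if n is n'.+1 then next_state n' (gen n') (next (n', gen n'))
  else (1%N, fun m k t => m = 0%N /\ k = t).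

Let N n : nat := (next (n, gen n)).1.1.
Let L n : nat := (next (n, gen n)).1.2.
Let S n : pred nat := (next (n, gen n)).2.
Let M n : nat := (M0 * (gen n).1)%N.

Let ances_fun n m k t t' : (gen n).2 m k t -> (gen n).2 m k t' -> t = t'.
Proof.
elim: n k => [|n IH] k /=; first by move=> [_ <-] [].
by case: eqP => [_ -> ->|_ [/IH h _] [/h]].
Qed.

Let gen_step n : (0 < (gen n).1)%N -> good_step n (gen n) (N n, L n, S n).
Proof.
move=> B0; have := nextP n B0 (@ances_fun n).
by rewrite /N /L /S; case: (next _) => [[]].
Qed.

Let B_gt0 n : (0 < (gen n).1)%N.
Proof.
elim: n => //= n IH; have [[N1 L0 _ _ _] _] := gen_step IH.
by rewrite !muln_gt0 IH L0 (ltnW N1).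
Qed.

Let N_gt1 n : (1 < N n)%N.
Proof. by have [[]] := gen_step (B_gt0 n). Qed.

Let L_gt0 n : (0 < L n)%N.
Proof. by have [[]] := gen_step (B_gt0 n). Qed.

Let NL_gt0 n : (0 < N n * L n)%N.
Proof. by rewrite muln_gt0 L_gt0 ltnW. Qed.

Let M_rec n : M n.+1 = (M n * (N n * L n))%N.
Proof. by rewrite /M /= mulnA. Qed.

Let M_gt0 n : (0 < M n)%N.
Proof. by rewrite muln_gt0 M0_gt0 B_gt0. Qed.

Let M_ge n : (2 ^ n <= M n)%N.
Proof.
elim: n => [|n IH]; first exact: M_gt0.
by rewrite M_rec expnSr leq_mul // -[leqLHS]muln1 leq_mul.
Qed.

Definition avoiding_set : set R := [set x | 0 <= x < (M0%:R)^-1 /\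
  exists m, forall j, (m <= j)%N -> S j (cell (M j.+1) x)].

Let gen_ances n m (x : R) : 0 <= x -> (m <= n)%N ->
  (forall j, (m <= j)%N -> S j (cell (M j.+1) x)) ->
  (gen n).2 m (cell (M n) x) (cell (M m) x).
Proof.
move=> x0 + Sx; elim: n => [|n IH]; first by rewrite leqn0 => /eqP ->.
rewrite leq_eqVlt => /predU1P[->|mn] /=; first by rewrite eqxx.
rewrite (ltn_eqF mn); split; last exact: Sx.
by rewrite -/(N n) -/(L n) M_rec cell_divn //; exact: IH.
Qed.

Let lower_boundedS n m t h : (m <= n)%N ->
  lower_bounded (gen n).1 (gen n).2 m t h ->
  lower_bounded (gen n.+1).1 (gen n.+1).2 m t h.
Proof.
move=> mn [c c0 clb]; exists c => // x xP; apply: clb => l.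
have [xl] := xP l; rewrite /= (ltn_eqF (mn : (m < n.+1)%N)) => -[Ax _].
have [x0 _] := andP xl; split=> //.
by move: Ax; rewrite -/(N n) -/(L n) mulnA (cell_divn (M_gt0 n) (NL_gt0 n) x0).
Qed.

Let lower_bounded_le n n' m t h : (m <= n)%N -> (n <= n')%N ->
  lower_bounded (gen n).1 (gen n).2 m t h ->
  lower_bounded (gen n').1 (gen n').2 m t h.
Proof.
move=> mn; elim: n' => [|n' IH]; first by rewrite leqn0 => /eqP ->.
rewrite leq_eqVlt => /predU1P[->//|]; rewrite ltnS => nn' lb.
by apply: lower_boundedS; [exact: leq_trans mn nn'|exact: IH].
Qed.

(** By induction on the remaining derivatives: the bound persists until a generation whose task is
    to remove the outermost one. *)
Let eventually_lower_bounded q (s : seq 'I_p.+2) m (t : {ffun 'I_p.+2 -> nat}) n :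
  injective t -> (m <= n)%N -> is_Cn (cube eta) (size s) (f q) ->
  lower_bounded (gen n).1 (gen n).2 m t (iter_partial q s) ->
  exists2 n', (m <= n')%N & lower_bounded (gen n').1 (gen n').2 m t (f q).
Proof.
move=> tinj; elim: s n => [|i s IH] n mn fC lb; first by exists n.
have [n' [j [nn' e]]] := pickle_unbounded ((q, i, s, m, t) : task) n.
have mn' := leq_trans mn nn'.
have gC : is_Cn (cube eta) 1 (iter_partial q s).
  by apply: is_Cn_foldr_partial; rewrite addn1.
have [_ /(_ q i s m t j e tinj mn' gC)] := gen_step (B_gt0 n').
move=> /(_ (lower_bounded_le mn nn' lb)) lb'.
apply: (IH n'.+1) => //; first exact: leqW.
exact: is_CnW.
Qed.

(** From a late generation [m] on, the coordinates of [x] are in selected cells, and their cells in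
    generation [m] are distinct and form [t]. The nonvanishing derivative is bounded below on the
    compact cube, and the tasks turn this into a lower bound for [|f q|] at [x]. *)
Lemma avoiding_set_avoids q (r : nat) (b : 'I_p.+2 -> nat) :
  is_Cn (cube eta) r (f q) -> (\sum_(i < p.+2) b i)%N = r ->
  (forall x, cube eta x -> multi_partial (cube eta) b (f q) x <> 0) ->
  forall x : 'rV[R]_p.+2, (forall i, avoiding_set (x ord0 i)) ->
    injective (fun i => x ord0 i) -> f q x <> 0.
Proof.
move=> fC br b0 x xE xinj.
have [s ss se] := multi_partial_foldr (cube eta) b (f q).
have x0 l : 0 <= x ord0 l by have [/andP[]] := xE l.
have /choice[ml mlP] : forall l, exists m, forall j, (m <= j)%N ->
    S j (cell (M j.+1) (x ord0 l)).
  by move=> l; have [_] := xE l.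
(* As [M m >= 2 ^ m >= m], cells of a generation [m >= far] are shorter than the distance of the two
   coordinates, if it is positive. *)
pose far (ll : 'I_p.+2 * 'I_p.+2) :=
  (Num.truncn `|x ord0 ll.1 - x ord0 ll.2|^-1).+1.
pose m := (\max_l ml l + \max_ll far ll)%N.
have mPm l j : (m <= j)%N -> S j (cell (M j.+1) (x ord0 l)).
  move=> mj; apply: mlP; apply: leq_trans mj; apply: leq_trans (leq_addr _ _).
  exact: leq_bigmax.
pose t := [ffun l => cell (M m) (x ord0 l)].
have tinj : injective t.
  move=> l l'; rewrite !ffunE => e; apply: xinj; apply/eqP.
  rewrite -subr_eq0 -normr_eq0; apply/negPn/negP => d0.
  have d_gt0 : 0 < `|x ord0 l - x ord0 l'| by rewrite lt_neqAle eq_sym d0 /=.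
  have : `|x ord0 l - x ord0 l'| < (M m)%:R^-1.
    have := cell_itv (M_gt0 m) (x0 l); have := cell_itv (M_gt0 m) (x0 l').
    rewrite -e -natr1 mulrDl mul1r ltr_norml.
    by move: (_ / _) => a /andP[a1 a2] /andP[a3 a4]; apply/andP; split; lra.
  apply/negP; rewrite -leNgt -[leRHS]invrK lef_pV2 ?posrE ?invr_gt0 ?ltr0n //.
  apply/ltW/(lt_le_trans (truncnS_gt _)); rewrite ler_nat.
  apply: leq_trans (M_ge m); apply: leq_trans (ltnW (ltn_expl _ (ltnSn 1))).
  rewrite /m; apply: leq_trans (leq_addl _ _).
  exact: (@leq_bigmax _ far (l, l')).
have gC : {within cube eta, continuous (iter_partial q s)}.
  have : is_Cn (cube eta) 0 (iter_partial q s).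
    by apply: is_Cn_foldr_partial; rewrite addn0 ss br.
  by case.
have [c c0 clb] : exists2 c, 0 < c & forall x, cube eta x -> c <= `|iter_partial q s x|.
  by apply: cube_lb => // y /b0; rewrite se.
have in_cube (y : 'rV[R]_p.+2) : (forall l, 0 <= y ord0 l < (M0%:R)^-1) -> cube eta y.
  by move=> yl l; have /andP[-> h] := yl l; rewrite /= (le_trans (ltW h)).
have lb : lower_bounded (gen m).1 (gen m).2 m t (iter_partial q s).
  by exists c => // y yP; apply: clb; apply: in_cube => l; have [] := yP l.
have fC' : is_Cn (cube eta) (size s) (f q) by rewrite ss br.
have [n mn [c' c'0 c'lb]] := eventually_lower_bounded tinj (leqnn m) fC' lb.
move=> fx0; have := c'lb x; rewrite fx0 normr0 leNgt c'0 => /(_ _)/negP; apply=> // l.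
split; first by have [] := xE l.
by rewrite ffunE; apply: gen_ances => // j; exact: mPm.
Qed.

(** By the integer condition in [good_step], [M n.+1] to the power [(n + 1) / ((p + 1) (n + 1) + 1)]
    is at most [N n]. With [e = 1 - s (p + 1)], this exponent exceeds [s] once [n + 1 > s / e]. *)
Let M_pow (s : R) : 0 < s -> s * p.+1%:R < 1 ->
  exists n0, forall n, (n0 <= n)%N -> (M n.+1)%:R `^ s <= (N n)%:R :> R.
Proof.
move=> s0 sp; pose e := 1 - s * p.+1%:R.
have e0 : 0 < e by rewrite subr_gt0.
exists (Num.truncn (s / e)) => n n0n.
have [[_ _ _ _ pw] _] := gen_step (B_gt0 n).
move: pw; rewrite -/(M n) -M_rec -(ler_nat R) !natrX => pw.
have a0 : 0 < n.+1%:R :> R by rewrite ltr0n.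
have Mn0 : 0 <= (M n.+1)%:R :> R by [].
have -> : s = n.+1%:R * (s / n.+1%:R) by rewrite mulrCA divff ?mulr1 // gt_eqF.
rewrite powRrM powR_mulrn //.
apply: (@le_trans _ _ (((N n)%:R ^+ (p.+1 * n.+1).+1) `^ (s / n.+1%:R))).
  apply: ge0_ler_powR => //; rewrite ?nnegrE ?exprn_ge0 // divr_ge0 // ltW //.
rewrite -powR_mulrn // -powRrM -[leRHS]powRr1 //.
apply: ler_powR; first by rewrite ler1n ltnW.
rewrite mulrA ler_pdivrMr // mul1r -natr1 natrM.
have : s / e < n.+1%:R.
  by apply: lt_le_trans (truncnS_gt _) _; rewrite ler_nat ltnS.
rewrite ltr_pdivrMr // /e; lra.
Qed.

Let E_sub m k (x : R) : (k < (gen m).1)%N -> 0 <= x -> cell (M m) x = k ->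
  (forall n, S (m + n) (cell (M (m + n).+1) x)) -> avoiding_set x.
Proof.
move=> kB x0 xk Sx; split; last first.
  by exists m => j mj; rewrite -(subnKC mj); exact: Sx.
rewrite x0 /=; have /andP[_ xlt] := cell_itv (M_gt0 m) x0.
apply: (lt_le_trans xlt); rewrite xk /M.
rewrite ler_pdivrMr ?ltr0n ?(M_gt0 m) // natrM mulrA mulVf ?mul1r ?ler_nat //.
by rewrite pnatr_eq0 gtn_eqF.
Qed.

(** The later generations inside the cell [k] of generation [m] form a Cantor construction to which
    the staircase applies. *)
Lemma avoiding_set_staircase (s : R) (m k : nat) : 0 < s -> s * p.+1%:R < 1 ->
  (k < (gen m).1)%N ->
  exists (F : R -> R) (C : R), [/\ 0 < C,
    {homo F : x y / x <= y},
    forall x y, 0 <= x -> x <= y -> F y <= F x + C * (y - x) `^ s &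
    forall y, 0 < y < 2^-1 -> exists x, [/\ avoiding_set x, cell (M m) x = k & F x = y]].
Proof.
move=> s0 sp kB; have [n0 n0P] := M_pow s0 sp.
pose M' n := M (m + n); pose N' n := N (m + n); pose L' n := L (m + n).
pose S' n := S (m + n).
have M'0 : (0 < M' 0)%N by exact: M_gt0.
have M'rec n : M' n.+1 = (M' n * (N' n * L' n))%N by rewrite /M' addnS M_rec.
have N'1 n : (1 < N' n)%N by exact: N_gt1.
have L'0 n : (0 < L' n)%N by exact: L_gt0.
have blk n : one_per_block (L' n) (S' n).
  by have [[]] := gen_step (B_gt0 (m + n)).
(* The proportion lost in generation [m + n] is at most [2 ^- (m + n).+2], within the [2 ^- n.+2]
   allowed after the shift. *)
have many n j : (2 ^ n.+2 * N' n <= 2 ^ n.+2 *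
    (\sum_(0 <= i < N' n * L' n) S' n (j * (N' n * L' n) + i)%N) + N' n)%N.
  have aux a c e : (2 ^ m * e * c <= 2 ^ m * e * a + c -> e * c <= e * a + c)%N.
    move=> h; have h2 : (0 < 2 ^ m)%N by rewrite expn_gt0.
    rewrite -(leq_pmul2l h2); apply: (@leq_trans (2 ^ m * (e * a) + c)).
      by rewrite !mulnA.
    by rewrite mulnDr leq_add2l leq_pmull.
  have [[_ _ _ /(_ j) h _] _] := gen_step (B_gt0 (m + n)).
  by apply: aux; rewrite -expnD !addnS.
have pw n : (n0 <= n)%N -> (M' n.+1)%:R `^ s <= (N' n)%:R :> R.
  by move=> nn; rewrite /M' addnS; apply: n0P; exact: leq_trans (leq_addl _ _).
have s1 : s < 1 by apply: le_lt_trans sp; rewrite ler_pMr // ler1n.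
have [C C0 holder] := staircase_holder k M'0 M'rec N'1 L'0 blk s0 s1 pw.
exists (staircase M' N' L' S' k), C; split=> //.
  exact: staircase_homo.
move=> y yP.
have [x [x0 xk Sx xy]] := staircase_onto k M'0 M'rec N'1 L'0 blk many s0 s1 pw yP.
exists x; split; [|by rewrite -xk /M' addn0|exact: xy].
apply: (@E_sub m k) => // [|n]; first by rewrite -xk /M' addn0.
by have := Sx n; rewrite /M' addnS.
Qed.

(** When two cells of generation [m] are shorter than [y - x], the cell following that of [x] lies
    between [x] and [y]. Its staircase takes the value [1/4] at a point of the set. *)
Lemma avoiding_set_dense (x y : R) : 0 <= x -> x < y -> y < (M0%:R)^-1 ->
  exists2 z, avoiding_set z & x <= z < y.
Proof.
move=> x0 xy yM.
pose m := (Num.truncn (2 / (y - x))).+1.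
have d0 : 0 < y - x by rewrite subr_gt0.
have Mm : 2 / (M m)%:R < y - x.
  rewrite ltr_pdivrMr ?ltr0n // mulrC -ltr_pdivrMr //.
  apply: (lt_le_trans (truncnS_gt _)); rewrite ler_nat.
  exact: leq_trans (ltnW (ltn_expl _ (ltnSn 1))) (M_ge _).
have /andP[x1 x2] := cell_itv (M_gt0 m) x0.
pose k := (cell (M m) x).+1.
have ky : k.+1%:R / (M m)%:R < y.
  by rewrite /k -addn2 natrD mulrDl; lra.
have kB : (k < (gen m).1)%N.
  rewrite ltnNge; apply/negP => Bk.
  have : (M0%:R)^-1 < y.
    apply: le_lt_trans ky; rewrite /M natrM invfM mulrA.
    rewrite -[leLHS]mul1r; rewrite mulrAC ler_pM2r ?invr_gt0 ?ltr0n //.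
    rewrite ler_pdivlMr ?ltr0n ?B_gt0 // mul1r ler_nat.
    exact: leqW.
  by rewrite ltNge (ltW yM).
pose s : R := (2 * p.+1%:R)^-1.
have p0 : 0 < p.+1%:R :> R by rewrite ltr0n.
have s0 : 0 < s by rewrite invr_gt0 mulr_gt0.
have sp : s * p.+1%:R < 1.
  have -> : s * p.+1%:R = 2^-1 by rewrite /s; field; rewrite gt_eqF.
  by rewrite invf_lt1 // ltr1n.
have [F [C [_ _ _ onto]]] := avoiding_set_staircase s0 sp kB.
have [|z [Ez zk _]] := onto 4^-1.
  by rewrite invr_gt0 ltr0n ltf_pV2 ?posrE ?ltr0n // ltr_nat.
have z0 : 0 <= z by have [/andP[]] := Ez.
exists z => //; have /andP[z1 z2] := cell_itv (M_gt0 m) z0.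
by rewrite zk in z1 z2; rewrite (le_trans (ltW x2) z1) (lt_trans z2).
Qed.

Lemma avoiding_set_dim : ((p.+1%:R^-1)%:E <= hausdorff_dim avoiding_set)%E.
Proof.
apply: hausdorff_dim_ge => s s0 sp.
have p0 : 0 < p.+1%:R :> R by rewrite ltr0n.
(* The exponent [s] may be 0, while the staircase needs a positive one below [1 / (p + 1)]. *)
have [t [st t0 tu]] : exists t, [/\ s <= t, 0 < t & t < p.+1%:R^-1].
  exists ((s + p.+1%:R^-1) / 2); rewrite !midf_le ?midf_lt ?(ltW sp) //.
  by rewrite divr_gt0 // ltr_wpDl // invr_gt0.
have tp : t * p.+1%:R < 1 by rewrite -ltr_pdivlMr // div1r.
have [F [C [C0 Fhomo holder onto]]] := avoiding_set_staircase t0 tp (B_gt0 0).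
apply: (@hausdorff_measure_holder_image _ _ F C s t) => // [x y Ex Ey|y].
  have x0 : 0 <= x by have [/andP[]] := Ex.
  have y0 : 0 <= y by have [/andP[]] := Ey.
  wlog xy : x y Ex Ey x0 y0 / x <= y.
    move=> H; have [h|/ltW h] := leP x y; first exact: H.
    by rewrite distrC (distrC x); exact: H.
  rewrite distrC (distrC x) ger0_norm ?subr_ge0 ?Fhomo //.
  by rewrite ger0_norm ?subr_ge0 // lerBlDl; exact: holder.
by move=> /onto[x [Ex _ Fx]]; exists x.
Qed.

End Construction.

Theorem theorem1p1 (R : realType) (eta : R) (eta_gt0 : 0 < eta)
    (v : nat) (v_ge3 : (3 <= v)%N)
    (Q : countType) (f : Q -> 'rV[R]_v -> R) (r : Q -> nat)
    (r_ge1 : forall q, (1 <= r q)%N)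
    (f_Cr : forall q, is_Cn (cube eta) (r q) (f q))
    (f_partial : forall q, exists b : 'I_v -> nat,
       (\sum_(i < v) b i)%N = r q /\
       forall x, cube eta x -> multi_partial (cube eta) b (f q) x <> 0) :
  exists E : set R,
    [/\ E `<=` `[0, eta],
        (((v%:R - 1)^-1)%:E <= hausdorff_dim E)%E,
        has_minkowski_dim E 1 &
        forall (q : Q) (x : 'rV[R]_v),
          (forall i, E (x ord0 i)) -> injective (fun i => x ord0 i) ->
          f q x <> 0].
Proof.
case: v v_ge3 f f_Cr f_partial => [|[|p]] // _ f f_Cr f_partial.
pose M0 := (Num.truncn eta^-1).+1.
have M0_gt0 : (0 < M0)%N by [].
have M0_eta : (M0%:R)^-1 <= eta.
  rewrite -[leRHS]invrK lef_pV2 ?posrE ?invr_gt0 ?ltr0n //.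
  exact: ltW (truncnS_gt _).
have /choice[next nextP] : forall nst : nat * state, exists NLS : nat * nat * pred nat,
    (0 < nst.2.1)%N ->
    (forall m k t t', nst.2.2 m k t -> nst.2.2 m k t' -> t = t') ->
    good_step eta f M0 nst.1 nst.2 NLS.
  move=> [n st] /=; have [|no] := pselect ((0 < st.1)%N /\
      (forall m k t t', st.2 m k t -> st.2 m k t' -> t = t')).
    move=> [B0 Afun].
    have [NLS ?] := good_step_exists eta_gt0 f M0_gt0 M0_eta n B0 Afun.
    by exists NLS.
  (* A default for states violating the invariants, which [gen] never reaches. *)
  by exists (0%N, 0%N, xpred0) => B0 Afun; case: no.
have stepP n (st : state) := nextP (n, st).
have E_eta : avoiding_set M0 next `<=` `[0, eta].
  move=> x [/andP[x0 xM] _]; rewrite /= in_itv /= x0.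
  exact: ltW (lt_le_trans xM M0_eta).
exists (avoiding_set M0 next); split=> //.
- have -> : p.+2%:R - 1 = p.+1%:R :> R by rewrite -natr1 addrK.
  exact: (avoiding_set_dim M0_gt0 stepP).
- apply: (@minkowski_dim1 _ _ (M0%:R)^-1 eta) => //.
  + by rewrite invr_gt0 ltr0n.
  + exact: ltW.
  exact: (avoiding_set_dense M0_gt0 stepP).
move=> q x; have [b [br b0]] := f_partial q.
exact: (avoiding_set_avoids eta_gt0 M0_gt0 M0_eta stepP (f_Cr q) br b0).
Qed.
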